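(* Let $\Gamma$ be a connected finite graph and let $\check{\mathcal D}\subset\mathcal M_\Gamma$ be its discriminant. The one-point compactification $\check{\mathcal D}^+$ has the structure of a finite regular CW complex of dimension $\dim\mathcal M_\Gamma-2=d-2$. In particular, the inclusion $\check{\mathcal M}_\Gamma:=\mathcal M_\Gamma\setminus\check{\mathcal D}\subset\mathcal M_\Gamma$ is open and dense.
   Context: $\Gamma=(\Gamma_0,\Gamma_1)$ is a connected finite graph (multiple edges and loop edges allowed) with geometric realization $|\Gamma|$, metrized so that each edge has length $1$. $\mathcal M_\Gamma$ is the real vector space of pairs $(E,W)$ of functions $E:\Gamma_0\to\mathbb R$, $W:\Gamma_1\to\mathbb R$; $d=\dim\mathcal M_\Gamma=|\Gamma_0|+|\Gamma_1|$. A CW complex is regular if its characteristic maps are embeddings. Good parameters. Let $U\subset\mathcal M_\Gamma$ be the open set of $(E,W)$ for which $E$ has a unique absolute minimum, and $V$ the open set for which $W$ is one-to-one. Put $\breve{\mathcal M}_\Gamma=U\cup V$, $\breve{\mathcal D}=\mathcal M_\Gamma\setminus\breve{\mathcal M}_\Gamma$. Then $U=\coprod_vU_v$ over $v\in\Gamma_0$ ($v$ the minimizer of $E$) and $V=\coprod_\sigma V_\sigma$ over total orderings $\sigma$ of $\Gamma_1$ ($\sigma$ the ordering by values of $W$). The $\sigma$-spanning tree $T_\sigma$ is obtained from $\Gamma$ by going through the edges in decreasing $\sigma$-order, discarding an edge exactly when the remaining graph stays connected. Let $N\subset\breve{\mathcal M}_\Gamma\times|\Gamma|$ be the union of all $U_v\times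 B_{1/3}(v)$ and all $V_\sigma\times|T_\sigma|(1/3)$, where $B_{1/3}(v)$ and $|T_\sigma|(1/3)$ are the open $1/3$-neighborhoods of $v$ and $|T_\sigma|$ in $|\Gamma|$. The projection $p_1:N\to\breve{\mathcal M}_\Gamma$ is a homotopy equivalence; with the projection $p_2:N\to|\Gamma|$ it induces $\breve q_*=(p_2)_*(p_1)_*^{-1}:H_1(\breve{\mathcal M}_\Gamma)\to H_1(\Gamma;\mathbb R)$. Cells. A height function is a pair $h=(h_0,h_1)$ with $h_0:\Gamma_0\to\{1,2\}$, $h_0^{-1}(1)\ne\emptyset$, and $h_1:\Gamma_1\to\{1,\dots,n\}$ surjective for some $n>0$. Each $(E,W)\in\breve{\mathcal D}$ has an associated height function: $h_0(i)=1$ iff $i$ is a minimum of $E$; $h_1$ is the surjection onto some $\{1,\dots,n\}$ with $h_1(\alpha)\le h_1(\alpha')$ iff $W_\alpha\le W_{\alpha'}$. $C(h)$ is the set of $(E,W)\in\breve{\mathcal D}$ with associated height function $h$. The nonempty $C(h)$, together with the point $\infty$, are the open cells of a CW structure on the one-point compactification $\breve{\mathcal D}^+$, of dimension $d-2$. Discriminant. Alexander duality for $\breve{\mathcal D}^+\subset\mathcal M_\Gamma^+=S^d$ gives $H^{d-2}(\breve{\mathcal D}^+)\cong H_1(\breve{\mathcal M}_\Gamma)$. A $(d-2)$-cell $C(h)$ is essential if its image under the composite $C^{d-2}(\breve{\mathcal D}^+)\to H^{d-2}(\breve{\mathcal D}^+)\cong H_1(\breve{\mathcal M}_\Gamma)\xrightarrow{\breve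 q_*}H_1(\Gamma;\mathbb R)$ is nonzero, where $C^{d-2}$ denotes integral cellular cochains (free abelian on the $(d-2)$-cells). The discriminant $\check{\mathcal D}$ is the closure of the union of the essential $(d-2)$-cells of $\breve{\mathcal D}$.
   Formalization: The dimension d-2 is asserted only when the discriminant is nonempty; for a tree, e.g. the path with two edges (d=5), there are no essential cells, so the compactified discriminant is a single point of dimension 0. *)

(* Defs.v *)
From HB Require Import structures.
From mathcomp Require Import all_boot all_order all_algebra generic_quotient.
From mathcomp Require Import all_classical all_reals topology normedtype.

Set Implicit Arguments.
Unset Strict Implicit.
Unset Printing Implicit Defensive.
Import Order.TTheory GRing.Theory Num.Theory.
Import numFieldNormedType.Exports.
Local Open Scope classical_set_scope.
Local Open Scope ring_scope.
Local Open Scope quotient_scope.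

(** * Finite graphs *)

(* Multiple edges and loops are allowed.  [gsrc]/[gtgt] parametrize each edge;
   nothing below depends on the direction chosen. *)
Record graph := Graph {
  gV : finType;
  gE : finType;
  gsrc : gE -> gV;
  gtgt : gE -> gV }.

(* Connectedness of the spanning subgraph of G with edge set T. *)
Definition adjacent (G : graph) (T : {set gE G}) : rel (gV G) := fun u v =>
  [exists e in T, [|| (gsrc e == u) && (gtgt e == v)
                    | (gsrc e == v) && (gtgt e == u)]].

Definition connected_by (G : graph) (T : {set gE G}) : bool :=
  (0 < #|gV G|)%N && [forall u, forall v, connect (adjacent T) u v].

Definition connected_graph (G : graph) : bool := connected_by [set: gE G]%SET.

(* [sigma] lists the edges of G in increasing order. *)
Definition edge_ordering (G : graph) (sigma : seq (gE G)) : bool :=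
  perm_eq sigma (enum (gE G)).

Definition sigma_tree (G : graph) (sigma : seq (gE G)) : {set gE G} :=
  foldl (fun T e => if connected_by (T :\ e)%SET then (T :\ e)%SET else T)
        [set: gE G]%SET (rev sigma).

(** * Geometric realization *)

Section Realization.
Context (R : realType) (G : graph).

Definition unit_interval : set R := [set` `[0, 1]].

Definition vertex_or_edge_space (c : gV G + gE G) : set R :=
  if c is inr _ then unit_interval else [set 0].

(* Disjoint union of the vertices and of one copy of [0, 1] for each edge. *)
Definition pre_realization : topologicalType :=
  {c : (gV G + gE G)%type & set_type (vertex_or_edge_space c)}.

Definition glue_normal_form (x : pre_realization) : gV G + gE G * R :=
  match projT1 x with
  | inl v => inl v
  | inr e => let t := \val (projT2 x) in
             if t == 0 then inl (gsrc e)
             else if t == 1 then inl (gtgt e) else inr (e, t)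
  end.

Definition glued : rel pre_realization :=
  fun x y => glue_normal_form x == glue_normal_form y.

Local Lemma glue_rel_refl : reflexive glued.
Proof. by move=> x; exact: eqxx. Qed.

Local Lemma glue_rel_sym : symmetric glued.
Proof. by move=> x y; exact: eq_sym. Qed.

Local Lemma glue_rel_trans : transitive glued.
Proof. by move=> y x z /eqP xy /eqP yz; apply/eqP; rewrite xy. Qed.

Definition glue_rel := EquivRel _ glue_rel_refl glue_rel_sym glue_rel_trans.

Definition realization := {eq_quot glue_rel}.

HB.instance Definition _ :=
  Topological.copy realization (quotient_topology realization).
HB.instance Definition _ := Quotient.on realization.

Lemma vertex_subproof : (0 : R) \in [set 0]%classic.
Proof. by rewrite inE. Qed.

Definition vertex_point (v : gV G) : realization :=
  \pi_realization (existT (fun c => set_type (vertex_or_edge_space c))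
    (inl v) (exist _ 0 vertex_subproof)).

Definition edge_point (e : gE G) (t : set_type unit_interval) : realization :=
  \pi_realization (existT (fun c => set_type (vertex_or_edge_space c))
    (inr e) t).

(* The spanning subgraph with edge set T (it contains all the vertices). *)
Definition subgraph_points (T : {set gE G}) : set realization :=
  range vertex_point `|` \bigcup_(e in [set` T]) range (edge_point e).

(* Length metric in which each edge has length 1: a piecewise linear path from
   x to y is a sequence of segments, (e, a, b) running from a to b in the
   edge e. *)
Definition unit_segment : Type :=
  gE G * set_type unit_interval * set_type unit_interval.

Fixpoint pl_path (x y : realization) (s : seq unit_segment) : Prop :=
  match s with
  | [::] => x = y
  | (e, a, b) :: s' => x = edge_point e a /\ pl_path (edge_point e b) y s'
  end.

Definition pl_length (s : seq unit_segment) : R :=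
  \sum_(p <- s) `|\val p.1.2 - \val p.2|.

Definition gdist (x y : realization) : R :=
  inf [set pl_length s | s in pl_path x y].

Definition open_neighborhood (r : R) (A : set realization) : set realization :=
  [set x | exists2 a, A a & gdist a x < r].

End Realization.

(** * Singular chains and cochains *)

(* The singular chains of a subspace Y of T are represented as chains of T all
   of whose simplices are continuous maps into Y. *)
Section Singular.
Context (R : realType).

Definition std_simplex (n : nat) : set 'rV[R]_n.+1 :=
  [set x | (forall i, 0 <= x ord0 i) /\ \sum_i x ord0 i = 1].
Arguments std_simplex n : clear implicits.

Definition simplex (n : nat) (T : Type) := set_type (std_simplex n) -> T.

Lemma simplex_map_subproof m n (f : 'I_m.+1 -> 'I_n.+1)
    (x : set_type (std_simplex m)) :
  (\row_j \sum_(i | f i == j) \val x ord0 i) \in std_simplex n.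
Proof.
case: x => x /= /set_mem[x0 x1]; apply/mem_set; split=> [j|].
  by rewrite mxE sumr_ge0.
under eq_bigr do rewrite mxE.
by rewrite -x1 (partition_big f xpredT).
Qed.

(* Affine map sending the i-th vertex to the f(i)-th vertex. *)
Definition simplex_map m n (f : 'I_m.+1 -> 'I_n.+1)
    (x : set_type (std_simplex m)) : set_type (std_simplex n) :=
  exist (fun y => y \in std_simplex n) _ (simplex_map_subproof f x).

Definition face (n : nat) (i : 'I_n.+2) (T : Type) (s : simplex n.+1 T) :
  simplex n T := s \o simplex_map (lift i).

Definition front_face (q p : nat) (T : Type) (s : simplex (q + p) T) :
  simplex q T := s \o simplex_map (fun k : 'I_q.+1 => inord k).

Definition back_face (q p : nat) (T : Type) (s : simplex (q + p) T) :
  simplex p T := s \o simplex_map (fun k : 'I_p.+1 => inord (q + k)).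

(* Free modules on a set S of generators: finitely supported functions S -> A;
   [push f] is the linear extension of f. *)
Definition push (A : nmodType) (S S' : choiceType) (f : S -> S') (c : S -> A) :
  S' -> A := fun t => \sum_(s \in [set s | f s = t]) c s.

Section Chains.
Context (A : nzRingType) (T : topologicalType).

Definition chain (n : nat) := simplex n T -> A.

Definition singular_in (Y : set T) n (s : simplex n T) : Prop :=
  continuous s /\ range s `<=` Y.

Definition chain_in (Y : set T) n (c : chain n) : Prop :=
  finite_set [set s | c s != 0] /\ (forall s, c s != 0 -> singular_in Y s).

Definition boundary n : chain n -> chain n.-1 :=
  match n with
  | 0 => fun _ _ => 0
  | m.+1 => fun c t =>
      \sum_(i < m.+2) (-1) ^+ i * push (fun s : simplex m.+1 T => face i s) c t
  end.

Definition cycle_in (Y : set T) n (c : chain n) : Prop :=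
  chain_in Y c /\ boundary c = (fun=> 0).

Definition bounds_in (Y : set T) n (c : chain n) : Prop :=
  exists2 b : chain n.+1, chain_in Y b & c = boundary b.

Definition homologous_in (Y : set T) n (c c' : chain n) : Prop :=
  bounds_in Y (fun s => c s - c' s).

Definition rel_cycle (Y B : set T) n (c : chain n) : Prop :=
  chain_in Y c /\ chain_in B (boundary c).

Definition rel_homologous (Y B : set T) n (c c' : chain n) : Prop :=
  exists b : chain n.+1, exists r : chain n,
    [/\ chain_in Y b, chain_in B r &
        forall s, c s - c' s = boundary b s + r s].

(* Cochains are arbitrary functions on simplices; only their values on the
   simplices of the subspace under consideration matter. *)
Definition cochain (n : nat) := simplex n T -> A.

Definition coboundary n (phi : cochain n) : cochain n.+1 :=
  fun s => \sum_(i < n.+2) (-1) ^+ i * phi (face i s).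

Definition cocycle_in (Y : set T) n (phi : cochain n) : Prop :=
  forall s : simplex n.+1 T, singular_in Y s -> coboundary phi s = 0.

Definition evaluate n (phi : cochain n) (c : chain n) : A :=
  \sum_(s \in [set: simplex n T]) phi s * c s.

(* Cap product: phi is evaluated on the front face. *)
Definition cap q p (phi : cochain q) (c : chain (q + p)) : chain p :=
  fun t => \sum_(s \in [set s : simplex (q + p) T | back_face s = t])
             phi (front_face s) * c s.

End Chains.

Definition push_chain (A : nzRingType) (T T' : topologicalType) (f : T -> T') n
  (c : chain A T n) : chain A T' n := push (fun s : simplex n T => f \o s) c.

(* c generates H_n(Y, B; Z).  Only used for groups isomorphic to Z, in which
   case c is determined up to sign. *)
Definition homology_generator (T : topologicalType) (Y B : set T) n
    (c : chain int T n) : Prop :=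
  rel_cycle Y B c /\
  forall c' : chain int T n, rel_cycle Y B c' ->
    exists k : int, rel_homologous Y B c' (fun s => k * c s).

End Singular.

(** * Finite CW complexes *)

Definition embedding (X Y : topologicalType) (f : X -> Y) : Prop :=
  [/\ continuous f, injective f &
      forall U : set X, open U -> exists2 V : set Y, open V & f @^-1` V = U].

Definition disk (R : realType) (n : nat) : set 'rV[R]_n :=
  [set x | \sum_i x ord0 i ^+ 2 <= 1].
Arguments disk R n : clear implicits.

Definition disk_interior (R : realType) (n : nat) : set (set_type (disk R n)) :=
  [set x : set_type (disk R n) | \sum_i (\val x : 'rV_n) ord0 i ^+ 2 < 1].
Arguments disk_interior R n : clear implicits.

Record finite_cw (R : realType) (X : topologicalType) := FiniteCW {
  cw_cell : finType;
  cw_cell_dim : cw_cell -> nat;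
  cw_map : forall i : cw_cell, set_type (disk R (cw_cell_dim i)) -> X;
  cw_hausdorff : hausdorff_space X;
  cw_map_continuous : forall i, continuous (@cw_map i);
  cw_map_inj : forall i, {in disk_interior R (cw_cell_dim i) &,
                            injective (@cw_map i)};
  cw_partition : forall x : X,
    exists! i, (@cw_map i @` disk_interior R (cw_cell_dim i)) x;
  cw_boundary : forall i p, ~ disk_interior R (cw_cell_dim i) p ->
    exists j, (cw_cell_dim j < cw_cell_dim i)%N /\
      (@cw_map j @` disk_interior R (cw_cell_dim j)) (cw_map p);
  cw_weak_topology : forall A : set X,
    (forall i, closed (@cw_map i @^-1` A)) -> closed A }.

Definition cw_regular (R : realType) (X : topologicalType) (K : finite_cw R X) :=
  forall i : cw_cell K, embedding (@cw_map R X K i).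

Definition cw_dim (R : realType) (X : topologicalType) (K : finite_cw R X) :=
  (\max_(i : cw_cell K) cw_cell_dim i)%N.

(** * Good parameters and the discriminant *)

Section Discriminant.
Context (R : realType) (G : graph).

Definition params : topologicalType :=
  ({ptws gV G -> R} * {ptws gE G -> R})%type.

Definition params_dim : nat := #|gV G| + #|gE G|.

Definition U_at (v : gV G) : set params :=
  [set x | forall u, u != v -> x.1 v < x.1 u].

Definition V_at (sigma : seq (gE G)) : set params :=
  [set x | injective x.2 /\ sorted (fun a b => x.2 a < x.2 b) sigma].

Definition good_params : set params :=
  [set x | (exists v, U_at v x) \/ injective x.2].

Definition bad_params : set params := ~` good_params.

Definition correspondence : set (params * realization R G)%type :=
  [set p |
     (exists v, U_at v p.1 /\
        open_neighborhood (1 / 3) [set vertex_point R v] p.2) \/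
     (exists sigma, [/\ edge_ordering sigma, V_at sigma p.1 &
        open_neighborhood (1 / 3)
          (@subgraph_points R G (sigma_tree sigma)) p.2])].

(* y is a cycle representing the image in H_1(Gamma; R) of the class of the
   integral 1-cycle z of good_params under (p_2)_* (p_1)_*^{-1}. *)
Definition q_image (z : chain R int params 1) (y : chain R R (realization R G) 1)
    : Prop :=
  exists n : chain R int (params * realization R G)%type 1,
    [/\ cycle_in correspondence n,
        homologous_in good_params (push_chain fst n) z &
        y = (fun s => (push_chain snd n s)%:~R)].

(* The values {1, 2} and {1, ..., n} are represented by 'I_2 and 'I_n, i
   standing for i + 1. *)
Record height_function := HeightFunction {
  height_n : nat;
  height0 : gV G -> 'I_2;
  height1 : gE G -> 'I_height_n;
  height0_min : exists v, height0 v = ord0;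
  height_n_gt0 : (0 < height_n)%N;
  height1_surj : forall k, exists a, height1 a = k }.

Definition has_height (h : height_function) (x : params) : Prop :=
  (forall i, height0 h i = ord0 <-> (forall j, x.1 i <= x.1 j)) /\
  (forall a a', (height1 h a <= height1 h a')%N <-> x.2 a <= x.2 a').

Definition cell (h : height_function) : set params :=
  bad_params `&` has_height h.

(* If nonempty, C(h) is an open convex cone: E is given by its minimal value
   and by its excess over it at the vertices of height 2, and W by its n
   distinct values in increasing order. *)
Definition cell_dim (h : height_function) : nat :=
  (1 + #|[set i | height0 h i != ord0]%SET| + height_n h)%N.

Definition is_cell (k : nat) (h : height_function) : Prop :=
  cell h !=set0 /\ cell_dim h = k.

(* Nonempty cells exist only if G has at least two vertices and two edges, in
   which case params_dim >= 4 and the subtraction is not truncated. *)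
Definition top_dim : nat := (params_dim - 2)%N.

Definition sphere : topologicalType := one_point_compactification params.

Definition finite_part (A : set params) : set sphere :=
  [set Some x | x in A].

Definition add_infinity (A : set params) : set sphere :=
  finite_part A `|` [set None].

(* The subspace \breve{D}^+ of the sphere M^+. *)
Definition bad_plus : set sphere := add_infinity bad_params.

(* The (d-3)-skeleton of \breve{D}^+. *)
Definition lower_skeleton : set sphere :=
  add_infinity (\bigcup_(h in [set h | (cell_dim h < top_dim)%N]) cell h).

(* phi is a singular cocycle of \breve{D}^+ representing the image in
   H^{d-2}(\breve{D}^+; Z) of the cellular cochain dual to the cell C(h): the
   class of phi in H^{d-2}(X^{(d-2)}, X^{(d-3)}) = C^{d-2}(X) takes the value
   +-1 on the generator of H_{d-2} of the closed cell C(h) relative to its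
   frontier, and 0 on those of the other (d-2)-cells.  The sign depends on the
   orientation of C(h). *)
Definition represents_dual_cell (h : height_function)
    (phi : cochain R int sphere top_dim) : Prop :=
  [/\ cocycle_in bad_plus phi,
      (forall s, singular_in lower_skeleton s -> phi s = 0) &
      forall h' (c : chain R int sphere top_dim), is_cell top_dim h' ->
        homology_generator (add_infinity (closure (cell h')))
          (add_infinity (closure (cell h') `\` cell h')) c ->
        (cell h' = cell h -> `|evaluate phi c| = 1) /\
        (cell h' <> cell h -> evaluate phi c = 0)].

(* The classes of phi in H^{d-2}(X; Z) and of z in H_1(S \ X; Z), where
   X = \breve{D}^+, S = M^+ and S \ X = \breve{M}, correspond to each other
   under Alexander duality.  This is the isomorphism
     H^{d-2}(X) = colim_U H^{d-2}(U) --> H_2(S, S \ X) --> H_1(S \ X),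
   the first arrow being the cap product with the fundamental class of S,
   localized in H_d(U, U \ X) = H_d(S, S \ X), and the second one the
   connecting homomorphism; U ranges over the open neighborhoods of X.  A
   representative on U can be corrected by a coboundary so as to restrict to
   phi itself.  mu is a fundamental cycle of S (either orientation; this
   changes the sign of z only). *)
Definition alexander_dual (phi : cochain R int sphere top_dim)
    (z : chain R int params 1) : Prop :=
  cycle_in good_params z /\
  exists (U : set sphere) (psi : cochain R int sphere top_dim)
         (mu m : chain R int sphere (top_dim + 2)),
    [/\ open U /\ bad_plus `<=` U,
        cocycle_in U psi /\
          (forall s, singular_in bad_plus s -> psi s = phi s),
        homology_generator [set: sphere] set0 mu,
        rel_cycle U (U `\` bad_plus) m /\
          rel_homologous [set: sphere] (~` bad_plus) m mu &
        homologous_in (~` bad_plus)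
          (push_chain (Some : params -> sphere) z) (boundary (cap psi m))].

Definition essential (h : height_function) : Prop :=
  is_cell top_dim h /\
  exists phi z y, [/\ represents_dual_cell h phi, alexander_dual phi z,
    q_image z y & ~ bounds_in [set: realization R G] y].

Definition discriminant : set params :=
  closure (\bigcup_(h in essential) cell h).

End Discriminant.

(* Main.v *)
Require Import Defs.
From mathcomp Require Import all_boot all_order all_algebra.
From mathcomp Require Import all_classical all_reals topology normedtype.
From mathcomp Require Import lra.

Set Implicit Arguments.
Unset Strict Implicit.
Unset Printing Implicit Defensive.
Import Order.TTheory GRing.Theory Num.Theory.
Import numFieldNormedType.Exports.
Local Open Scope classical_set_scope.
Local Open Scope ring_scope.

(** Each closed cell of the discriminant contains the plane where E and W are
    both constant, and the one-point compactification of a plane is a sphere; so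
    the cells C(h) themselves do not form a regular complex.  They are
    subdivided until every closed cone is pointed, that is, an orthant.

    A pair (E, W) is read as one function x on the vertices, the edges and one
    further point, at which x is 0.  Cut the parameter space according to the
    total preorder that x induces on this finite set: this is the fan of the
    braid arrangement.  Up to an additive constant, x is in a unique way a sum
    of y_A times the indicator function of A with y_A > 0, where A runs over a
    chain of nonempty proper subsets, namely the strict superlevel sets of x.
    The y_A are the gaps between consecutive values of x.  Hence the gaps are
    global coordinates that depend continuously on x ([gap_continuous],
    [layer_gap]), in which the cones of the fan become coordinate orthants
    ([gap_layer]).

    Whether (E, W) lies in C(h) depends only on the preorder, so C(h) is a union
    of open cones of the fan, and the closure of a union of cells C(h) consists
    of all the faces of these cones ([closed_cell_faces], [of_fan_closed]).  In
    the gap coordinates the discriminant is thus the set of nonnegative vectors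
    whose support belongs to a family of finite sets stable under taking
    subsets.  The one-point compactification of such a set is a regular complex
    ([conical_complex]): a k-dimensional orthant together with infinity is a
    closed k-disk, because an inversion centered on the boundary sphere turns
    the disk into a half-space, which a shear along the diagonal turns into an
    orthant ([orthant]).  The characteristic maps obtained in this way are
    continuous and injective from a compact space to a Hausdorff one, hence
    embeddings.

    The dimension of an open cone is the number of distinct nonzero values of x.
    On C(h) it is at most the dimension of C(h), with equality at a point where only
    the values that h forces to be equal coincide ([card_levels_generic]).

    The discriminant is closed by definition.  It avoids the set where E has a
    unique minimum, which is open, and dense since E can be lowered at one of
    its minima ([U_at_open], [U_dense]). *)

(** * Topological preliminaries *)

Lemma ptws_cvg (I : eqType) (T : topologicalType) (F : set_system {ptws I -> T})
    (f : {ptws I -> T}) :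
  Filter F -> (forall i, (fun g : {ptws I -> T} => g i) @ F --> f i) -> F --> f.
Proof.
move=> FF cvF; apply/cvg_sup => i; apply/cvg_image.
  by rewrite eqEsubset; split=> v // _; exists (fun=> v).
move=> W /(cvF i) /= FW; exists (@^~ i @^-1` W) => //.
by rewrite eqEsubset; split => [j [? + <-//]|j Wj]; exists (fun=> j).
Qed.

Lemma ptws_continuous_at (I : eqType) (S T : topologicalType)
    (f : S -> {ptws I -> T}) (x : S) :
  (forall i, {for x, continuous (fun s => f s i)}) -> {for x, continuous f}.
Proof. by move=> cf; apply: ptws_cvg => i; exact: cf. Qed.

Lemma ptws_eval_continuous (I : eqType) (T : topologicalType) (i : I) :
  continuous (fun g : {ptws I -> T} => g i).
Proof. exact: (@proj_continuous I (fun=> T) i). Qed.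

Lemma ptws_hausdorff (I : eqType) (T : topologicalType) :
  hausdorff_space T -> hausdorff_space {ptws I -> T}.
Proof. by move=> hT; apply: (@hausdorff_product I (fun=> T)) => _. Qed.

(** The default value of the minimum is allowed to vary, which covers minima of
    nonempty families without a neutral element. *)
Lemma bigmin_continuous (R : realType) (T : topologicalType) (I : Type)
    (r : seq I) (P : pred I) (f0 : T -> R) (f : I -> T -> R) (x : T) :
  {for x, continuous f0} -> (forall i, {for x, continuous (f i)}) ->
  {for x, continuous (fun t => \big[Num.min/f0 t]_(i <- r | P i) f i t)}.
Proof.
move=> c0 cf; elim: r => [|i r IH].
  by rewrite (_ : (fun=> _) = f0)//; apply/funext => t; rewrite big_nil.
case Pi : (P i); last first.
  rewrite (_ : (fun=> _) = fun t => \big[Num.min/f0 t]_(i <- r | P i) f i t)//.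
  by apply/funext => t; rewrite big_cons Pi.
rewrite (_ : (fun=> _) =
    (f i) \min (fun t => \big[Num.min/f0 t]_(i <- r | P i) f i t)).
  exact: continuous_min.
by apply/funext => t; rewrite big_cons Pi.
Qed.

Section RealContinuity.
Context (R : realType) (T : topologicalType) (f g : T -> R) (x : T).

Lemma cst_continuous_at (c : R) : {for x, continuous (fun _ : T => c)}.
Proof. exact: cvg_cst. Qed.

Lemma add_continuous_at : {for x, continuous f} -> {for x, continuous g} ->
  {for x, continuous (fun t => f t + g t)}.
Proof. by move=> cf cg; exact: (cvgD cf cg). Qed.

Lemma sub_continuous_at : {for x, continuous f} -> {for x, continuous g} ->
  {for x, continuous (fun t => f t - g t)}.
Proof. by move=> cf cg; exact: (cvgB cf cg). Qed.

Lemma mul_continuous_at : {for x, continuous f} -> {for x, continuous g} ->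
  {for x, continuous (fun t => f t * g t)}.
Proof. by move=> cf cg; exact: (cvgM cf cg). Qed.

End RealContinuity.

Lemma sum_continuous_at (R : realType) (T : topologicalType) (I : finType)
    (P : pred I) (f : I -> T -> R) (x : T) :
  (forall i, P i -> {for x, continuous (f i)}) ->
  {for x, continuous (fun t => \sum_(i | P i) f i t)}.
Proof.
move=> cf; apply: (@cvg_big R I +%R 0 P _ T (nbhs x) _ f _ _ cf).
exact: add_continuous.
Qed.

Lemma bigmin_mem (d : Order.disp_t) (T : orderType d) (I : finType)
    (P : pred I) (x0 : T) (f : I -> T) :
  \big[Order.min/x0]_(i | P i) f i = x0 \/
  exists2 i, P i & \big[Order.min/x0]_(i | P i) f i = f i.
Proof.
elim/big_ind : _ => [||i Pi]; [by left| |by right; exists i].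
by move=> x y hx hy; rewrite /Order.min; case: ifP.
Qed.

Section Embeddings.
Context (X Y : topologicalType) (f : X -> Y).

(** A cluster point of the image filter lies in K, hence is the image of a
    point, and this point is a cluster point since the topology of X is the one
    induced by f. *)
Lemma embedding_compact_preimage (K : set Y) :
  embedding f -> compact K -> K `<=` range f -> compact (f @^-1` K).
Proof.
move=> [cf fI fopen] cK Kf F PF FK.
have [|y [/[dup] Ky /Kf[x _ fxy] cly]] := cK (f @ F) _; first exact: FK.
exists x; split; first by rewrite /= fxy.
move=> A B FA; rewrite nbhsE => -[U [oU Ux] UB].
have [V oV VU] := fopen U oU.
have Vy : nbhs y V.
  by apply: open_nbhs_nbhs; split => //; rewrite -fxy -[V _]/((f @^-1` V) x) VU.
have [|_ [[a Aa <-] Va]] := cly (f @` A) V _ Vy.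
  by apply: (@filterS _ F _ A) FA => a Aa; exists a.
by exists a; split => //; apply: UB; rewrite -VU.
Qed.

Lemma compact_injective_embedding :
  compact [set: X] -> hausdorff_space Y -> continuous f -> injective f ->
  embedding f.
Proof.
move=> cX hY cf fI; split=> // U oU; exists (~` (f @` (~` U))).
  apply/closed_openC/(compact_closed hY)/continuous_compact.
    exact: continuous_subspaceT.
  by apply: subclosed_compact cX _ => //; exact: open_closedC.
apply/seteqP; split=> x /=; first by apply: contra_notP => nUx; exists x.
by move=> Ux [y nUy /fI yx]; apply: nUy; rewrite yx.
Qed.

End Embeddings.

Lemma set_val_embedding (T : topologicalType) (A : set T) :
  embedding (fun x : set_type A => \val x).
Proof.
split; [exact: initial_continuous | exact: val_inj|].
by move=> U [V oV VU]; exists V.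
Qed.

Lemma compact_set_type (T : topologicalType) (A : set T) :
  compact A -> compact [set: set_type A].
Proof.
move=> cA; have := embedding_compact_preimage (@set_val_embedding _ A) cA.
rewrite (_ : _ @^-1` A = setT); first by apply=> x Ax; exists (exist _ x (mem_set Ax)).
by apply/seteqP; split=> // -[x Ax] _ /=; exact/set_mem.
Qed.

(** * The disk as a compactified orthant *)

Section DiskToOrthant.
Context (R : realType).

Definition sqnorm k (x : 'rV[R]_k) : R := \sum_i x ord0 i ^+ 2.

(** The squared distance to the pole, the unit vector of the first axis.  Written
    as a sum over the indices of value 0 it also makes sense for k = 0, where
    there is no pole and it is 1. *)
Definition pole_dist k (x : 'rV[R]_k) : R :=
  1 - 2 * (\sum_(i < k | val i == 0%N) x ord0 i) + sqnorm x.

(** The inversion of center the pole and radius sqrt 2 maps the unit disk to a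
    half-space bounded by the hyperplane through 0 orthogonal to the axis of the
    pole; [depth] is the distance of the image to this hyperplane and [shadow]
    its orthogonal projection on it. *)
Definition depth k (x : 'rV[R]_k) : R := (1 - sqnorm x) / pole_dist x.

Definition shadow k (x : 'rV[R]_k) (i : 'I_k) : R :=
  if val i == 0%N then 0 else 2 * x ord0 i / pole_dist x.

(** The vector whose projection along the diagonal to the hyperplane of vanishing
    first coordinate is the shadow, and whose least coordinate is the depth.
    The minimum of the shadow may start at 0 since its first coordinate is 0. *)
Definition orthant k (x : 'rV[R]_k) (i : 'I_k) : R :=
  depth x + shadow x i - \big[Num.min/0]_j shadow x j.

Lemma sqnormS n (x : 'rV[R]_n.+1) :
  sqnorm x = x ord0 ord0 ^+ 2 + \sum_(i < n) x ord0 (lift ord0 i) ^+ 2.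
Proof. exact: big_ord_recl. Qed.

Lemma pole_distS n (x : 'rV[R]_n.+1) :
  pole_dist x =
    (1 - x ord0 ord0) ^+ 2 + \sum_(i < n) x ord0 (lift ord0 i) ^+ 2.
Proof. by rewrite /pole_dist sqnormS (big_pred1 ord0) //; lra. Qed.

Lemma sum_sqr_ge0 n (f : 'I_n -> R) : 0 <= \sum_i f i ^+ 2.
Proof. by apply: sumr_ge0 => i _; exact: sqr_ge0. Qed.

Lemma pole_dist_ge0 k (x : 'rV[R]_k) : 0 <= pole_dist x.
Proof.
case: k x => [|n] x; first by rewrite /pole_dist /sqnorm !big_ord0; lra.
by rewrite pole_distS addr_ge0 ?sqr_ge0 ?sum_sqr_ge0.
Qed.

Lemma pole_dist0P n (x : 'rV[R]_n.+1) : pole_dist x = 0 ->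
  x ord0 ord0 = 1 /\ forall i, x ord0 (lift ord0 i) = 0.
Proof.
move=> /eqP; rewrite pole_distS paddr_eq0 ?sqr_ge0 ?sum_sqr_ge0//.
rewrite sqrf_eq0 => /andP[/eqP x0 /eqP s0]; split; first by lra.
move=> i; apply/eqP; rewrite -sqrf_eq0; apply/eqP.
by apply: (psumr_eq0P _ s0) => // j _; exact: sqr_ge0.
Qed.

Lemma pole_inj k (x y : 'rV[R]_k) :
  pole_dist x = 0 -> pole_dist y = 0 -> x = y.
Proof.
case: k x y => [|n] x y; first by move=> _ _; apply/rowP => -[].
move=> /pole_dist0P[x0 xi] /pole_dist0P[y0 yi]; apply/rowP => i.
by case: (unliftP ord0 i) => [j|] ->; rewrite ?xi ?yi ?x0 ?y0.
Qed.

Lemma interior_pole_dist_gt0 k (x : 'rV[R]_k) : sqnorm x < 1 -> 0 < pole_dist x.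
Proof.
move=> x1; rewrite lt_def pole_dist_ge0 andbT; apply/eqP.
case: k x x1 => [|n] x x1.
  by rewrite /pole_dist /sqnorm !big_ord0; lra.
move=> /pole_dist0P[x0 xi]; move: x1.
by rewrite sqnormS x0 big1 => [|i _]; rewrite ?xi; lra.
Qed.

Lemma shadow0 n (x : 'rV[R]_n.+1) : shadow x ord0 = 0. Proof. by []. Qed.

Lemma shadow_lift n (x : 'rV[R]_n.+1) (i : 'I_n) :
  shadow x (lift ord0 i) = 2 * x ord0 (lift ord0 i) / pole_dist x.
Proof. by []. Qed.

Lemma orthant_ge_depth k (x : 'rV[R]_k) i : depth x <= orthant x i.
Proof. by rewrite /orthant -addrA lerDl subr_ge0 bigmin_le. Qed.

Lemma orthant_eq_depth n (x : 'rV[R]_n.+1) : exists i, orthant x i = depth x.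
Proof.
have [m0|[i _ mi]] := bigmin_mem xpredT 0 (shadow x).
  by exists ord0; rewrite /orthant m0 shadow0; lra.
by exists i; rewrite /orthant mi; lra.
Qed.

Lemma orthant_shadow n (x : 'rV[R]_n.+1) i :
  shadow x i = orthant x i - orthant x ord0.
Proof. by rewrite /orthant shadow0; lra. Qed.

Lemma depth_ge0 k (x : 'rV[R]_k) : sqnorm x <= 1 -> 0 <= depth x.
Proof. by move=> x1; rewrite divr_ge0 ?pole_dist_ge0//; lra. Qed.

Lemma depth_gt0 k (x : 'rV[R]_k) : sqnorm x < 1 -> 0 < depth x.
Proof. by move=> x1; rewrite divr_gt0 ?interior_pole_dist_gt0//; lra. Qed.

Let sqr_double_div (a b : R) : (2 * a / b) ^+ 2 = 4 / b ^+ 2 * a ^+ 2.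
Proof. by rewrite expr_div_n exprMn mulrAC -natrX. Qed.

(** The image of x is at distance 2 / |x - pole| from the pole; the two
    identities allow one to recover x from its shadow and its depth. *)
Lemma inversion n (x : 'rV[R]_n.+1) : 0 < pole_dist x ->
  depth x + 1 = 2 * (1 - x ord0 ord0) / pole_dist x /\
  (\sum_i shadow x i ^+ 2 + (depth x + 1) ^+ 2) * pole_dist x = 4.
Proof.
move=> Q0; have Qn : pole_dist x != 0 by rewrite gt_eqF.
have d1 : depth x + 1 = 2 * (1 - x ord0 ord0) / pole_dist x.
  rewrite /depth -[X in _ + X](divff Qn) -mulrDl; congr (_ / _).
  rewrite sqnormS pole_distS; lra.
split=> //; rewrite d1 big_ord_recl shadow0 expr0n/= add0r.
under eq_bigr do rewrite shadow_lift.
have -> : \sum_(i < n) (2 * x ord0 (lift ord0 i) / pole_dist x) ^+ 2 =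
   4 / pole_dist x ^+ 2 * \sum_(i < n) x ord0 (lift ord0 i) ^+ 2.
  rewrite big_distrr/=; apply: eq_bigr => i _.
  exact: sqr_double_div.
have -> : (2 * (1 - x ord0 ord0) / pole_dist x) ^+ 2 =
    4 / pole_dist x ^+ 2 * (1 - x ord0 ord0) ^+ 2.
  exact: sqr_double_div.
rewrite -mulrDr [X in _ * X * _]addrC -pole_distS -mulrA -expr2 mulfVK//.
by rewrite expf_neq0.
Qed.

Lemma orthant_inj k (x y : 'rV[R]_k) : 0 < pole_dist x -> 0 < pole_dist y ->
  orthant x =1 orthant y -> x = y.
Proof.
case: k x y => [|n] x y Qx Qy xy; first by apply/rowP => -[].
have sh i : shadow x i = shadow y i by rewrite !orthant_shadow !xy.
have dp : depth x = depth y.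
  have [i ix] := orthant_eq_depth x; have [j jy] := orthant_eq_depth y.
  have := orthant_ge_depth x j; have := orthant_ge_depth y i.
  by rewrite -xy ix xy jy; lra.
have [dx Px] := inversion Qx; have [dy Py] := inversion Qy.
have Qe : pole_dist x = pole_dist y.
  have : \sum_i shadow x i ^+ 2 + (depth x + 1) ^+ 2 != 0.
    by apply/eqP => s0; move: Px; rewrite s0; lra.
  move/mulfI; apply; rewrite Px -Py dp; congr ((_ + _) * _).
  by apply: eq_bigr => i _; rewrite sh.
have Qn : pole_dist y != 0 by rewrite gt_eqF.
apply/rowP => i; case: (unliftP ord0 i) => [j|] ->.
  have := sh (lift ord0 j); rewrite !shadow_lift Qe.
  by move/(mulIf (invr_neq0 Qn)); lra.
by move: dx; rewrite dp dy Qe => /(mulIf (invr_neq0 Qn)); lra.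
Qed.

(** The preimage is found by undoing the shear, then applying the same inversion,
    which is an involution. *)
Lemma orthant_surj k (y : 'I_k -> R) : (forall i, 0 <= y i) ->
  exists x, [/\ sqnorm x <= 1, 0 < pole_dist x & orthant x =1 y].
Proof.
case: k y => [|n] y y0.
  exists 0; split=> [||[]//]; first by rewrite /sqnorm big_ord0.
  by rewrite /pole_dist /sqnorm !big_ord0; lra.
pose p i := y i - y ord0; pose l := \big[Num.min/0]_j p j.
pose m := y ord0 + l.
have m0 : 0 <= m.
  rewrite /m /l; have [->|[i _ ->]] := bigmin_mem xpredT 0 p; rewrite /p.
    by have := y0 ord0; lra.
  by have := y0 i; lra.
pose P := \sum_i p i ^+ 2 + (m + 1) ^+ 2.
have P0 : 0 < P.
  by apply: ltr_wpDl; rewrite ?sum_sqr_ge0// exprn_gt0//; lra.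
have Pn : P != 0 by rewrite gt_eqF.
have PE : P = \sum_(i < n) p (lift ord0 i) ^+ 2 + (m + 1) ^+ 2.
  by rewrite /P big_ord_recl /p; lra.
pose x : 'rV[R]_n.+1 :=
  \row_i (if val i == 0%N then 1 - 2 * (m + 1) / P else 2 * p i / P).
have x0 : x ord0 ord0 = 1 - 2 * (m + 1) / P by rewrite mxE.
have xi i : x ord0 (lift ord0 i) = 2 * p (lift ord0 i) / P by rewrite mxE.
have Q4 : pole_dist x = 4 / P.
  rewrite pole_distS x0; under eq_bigr do rewrite xi.
  have -> : \sum_(i < n) (2 * p (lift ord0 i) / P) ^+ 2 =
     4 / P ^+ 2 * \sum_(i < n) p (lift ord0 i) ^+ 2.
    rewrite big_distrr/=; apply: eq_bigr => i _.
    exact: sqr_double_div.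
  have -> : (1 - (1 - 2 * (m + 1) / P)) ^+ 2 = 4 / P ^+ 2 * (m + 1) ^+ 2.
    rewrite opprB addrC subrK.
    exact: sqr_double_div.
  by rewrite -mulrDr addrC -PE expr2 invfM -!mulrA mulVf// mulr1.
have double_div_quad a : 2 * (2 * a / P) / pole_dist x = a.
  rewrite Q4 invf_div (_ : _ * _ = a * (P / P)); last by lra.
  by rewrite divff ?mulr1.
have Q0 : 0 < pole_dist x by rewrite Q4 divr_gt0.
have Qn : pole_dist x != 0 by rewrite gt_eqF.
have [dx _] := inversion Q0.
have dm : depth x = m.
  suff : depth x + 1 = m + 1 by lra.
  rewrite dx x0 (_ : 1 - _ = 2 * (m + 1) / P); last by lra.
  exact: double_div_quad.
have shp i : shadow x i = p i.
  case: (unliftP ord0 i) => [j|] ->; last by rewrite shadow0 /p subrr.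
  by rewrite shadow_lift xi double_div_quad.
exists x; split=> //.
  by move: m0; rewrite -dm /depth pmulr_lge0 ?invr_gt0//; lra.
move=> i; rewrite /orthant dm shp (eq_bigr p) => [|j _]; last exact: shp.
by rewrite -/l /m /p; lra.
Qed.

Lemma orthant_ge0 k (x : 'rV[R]_k) i : sqnorm x <= 1 -> 0 <= orthant x i.
Proof. by move=> /depth_ge0 /le_trans; apply; exact: orthant_ge_depth. Qed.

Lemma orthant_gt0 k (x : 'rV[R]_k) i : sqnorm x < 1 -> 0 < orthant x i.
Proof. by move=> /depth_gt0 /lt_le_trans; apply; exact: orthant_ge_depth. Qed.

Lemma orthant_boundary k (x : 'rV[R]_k) :
  sqnorm x = 1 -> exists i, orthant x i = 0.
Proof.
case: k x => [|n] x x1; first by move: x1; rewrite /sqnorm big_ord0; lra.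
have [i xi] := orthant_eq_depth x; exists i.
by rewrite xi /depth x1 subrr mul0r.
Qed.

(** Continuity at the pole, when infinity is taken as its image: bounded
    coordinates bound the shadow and the depth, hence the distance of the image
    to the pole, which is inversely proportional to that of x. *)
Lemma orthant_unbounded k (M : R) : exists2 e, 0 < e &
  forall x : 'rV[R]_k, sqnorm x <= 1 -> 0 < pole_dist x < e ->
    exists i, M < orthant x i.
Proof.
case: k => [|n].
  exists 1 => // x; rewrite /pole_dist /sqnorm !big_ord0; lra.
pose B := n.+1%:R * M ^+ 2 + (`|M| + 1) ^+ 2.
have B0 : 0 < B.
  apply: ltr_wpDl; first by rewrite mulr_ge0 ?sqr_ge0.
  by rewrite exprn_gt0// ltr_wpDl.
exists (4 / B) => [|x x1 /andP[Q0 Qe]]; first by rewrite divr_gt0.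
apply: contrapT => nM; have leM i : orthant x i <= M.
  by rewrite leNgt; apply/negP => Mi; apply: nM; exists i.
have [_ PQ] := inversion Q0.
have sh i : shadow x i ^+ 2 <= M ^+ 2.
  have M0 : 0 <= M by apply: le_trans (leM i); exact: orthant_ge0.
  rewrite -(real_normK (num_real _)) lerXn2r ?nnegrE//.
  rewrite orthant_shadow ler_norml.
  by have := leM i; have := leM ord0; have := orthant_ge0 i x1;
    have := orthant_ge0 ord0 x1; lra.
have dp : (depth x + 1) ^+ 2 <= (`|M| + 1) ^+ 2.
  rewrite lerXn2r ?nnegrE ?addr_ge0 ?depth_ge0// lerD2r.
  apply: le_trans (orthant_ge_depth x ord0) _.
  by apply: le_trans (leM ord0) _; exact: ler_norm.
have PB : \sum_i shadow x i ^+ 2 + (depth x + 1) ^+ 2 <= B.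
  apply: (lerD _ dp); apply: le_trans (ler_sum _ (fun i _ => sh i)) _.
  by rewrite sumr_const card_ord /B mulr_natl.
have := ler_wpM2r (ltW Q0) PB; rewrite PQ leNgt => /negP; apply.
by rewrite mulrC -ltr_pdivlMr.
Qed.

Lemma sqnorm_continuous k : continuous (@sqnorm k).
Proof.
move=> x; apply: sum_continuous_at => i _; rewrite /continuous_at.
by apply: mul_continuous_at; exact: (@coord_continuous R 1 k).
Qed.

Lemma pole_dist_continuous k : continuous (@pole_dist k).
Proof.
move=> x; change {for x, continuous (fun z : 'rV[R]_k =>
  1 - 2 * (\sum_(i < k | val i == 0%N) z ord0 i) + sqnorm z)}.
apply: add_continuous_at; last exact: sqnorm_continuous.
apply: sub_continuous_at; first exact: cst_continuous_at.
apply: mul_continuous_at; first exact: cst_continuous_at.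
by apply: sum_continuous_at => i _; exact: (@coord_continuous R 1 k).
Qed.

Lemma orthant_continuous k (x : 'rV[R]_k) i : 0 < pole_dist x ->
  {for x, continuous (fun z => orthant z i)}.
Proof.
move=> Q0.
have cV : {for x, continuous (fun z => (pole_dist z)^-1)}.
  apply: (@cvgV R _ (nbhs x) _ (@pole_dist k) (pole_dist x)).
    by rewrite gt_eqF.
  exact: pole_dist_continuous.
have csh j : {for x, continuous (fun z => shadow z j)}.
  rewrite /shadow; case: (val j == 0%N); first exact: cst_continuous_at.
  apply: mul_continuous_at => //; apply: mul_continuous_at.
    exact: cst_continuous_at.
  exact: (@coord_continuous R 1 k).
rewrite /orthant; apply: sub_continuous_at.
  apply: add_continuous_at => //; rewrite /depth.
  apply: mul_continuous_at => //; apply: sub_continuous_at; [exact: cst_continuous_at|exact: sqnorm_continuous].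
by apply: bigmin_continuous => //; exact: cst_continuous_at.
Qed.

End DiskToOrthant.

(** * Compactified unions of coordinate orthants *)

Section ConicalComplex.
Context (R : realType) (J : finType).

Definition carrier (y : J -> R) : {set J} := [set j | y j != 0]%SET.

Definition conical (faces : pred {set J}) : set {ptws J -> R} :=
  [set y | (forall j, 0 <= y j) /\ faces (carrier y)].

Definition extend (S : {set J}) (v : 'I_#|S| -> R) : {ptws J -> R} :=
  fun j => \sum_(i | enum_val i == j) v i.

Lemma extend_val (S : {set J}) (v : 'I_#|S| -> R) i : extend v (enum_val i) = v i.
Proof.
rewrite /extend (big_pred1 i)// => j /=; apply/eqP/eqP => [/enum_val_inj//|->//].
Qed.

Lemma extend_out (S : {set J}) (v : 'I_#|S| -> R) j : j \notin S -> extend v j = 0.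
Proof.
move=> jS; rewrite /extend big_pred0// => i; apply/negP => /eqP ij.
by move: jS; rewrite -ij enum_valP.
Qed.

Lemma extend_ge0 (S : {set J}) (v : 'I_#|S| -> R) :
  (forall i, 0 <= v i) -> forall j, 0 <= extend v j.
Proof. by move=> v0 j; apply: sumr_ge0 => i _. Qed.

Lemma carrier_extend_sub (S : {set J}) (v : 'I_#|S| -> R) :
  carrier (extend v) \subset S.
Proof.
apply/fintype.subsetP => j; rewrite inE; apply: contraR => jS.
by rewrite extend_out.
Qed.

Lemma carrier_extend (S : {set J}) (v : 'I_#|S| -> R) :
  (carrier (extend v) == S) = [forall i, v i != 0].
Proof.
apply/eqP/forallP => [SE i|v0].
  have : enum_val i \in carrier (extend v) by rewrite SE enum_valP.
  by rewrite inE extend_val.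
apply/eqP; rewrite finset.eqEsubset carrier_extend_sub/=; apply/fintype.subsetP => j jS.
by rewrite -(enum_rankK_in jS jS) inE extend_val.
Qed.

Context (X : topologicalType) (f : X -> {ptws J -> R}) (faces : pred {set J}).
Hypotheses (f_embedding : embedding f) (f_range : range f = conical faces).
Hypothesis faces_down : forall S S' : {set J}, S' \subset S -> faces S -> faces S'.

Local Notation Xplus := (one_point_compactification X).

Lemma chart_conical x : conical faces (f x).
Proof. by rewrite -f_range; exists x. Qed.

Lemma chart_coord_continuous j : continuous (fun x => f x j).
Proof.
move=> x; have [cf _ _] := f_embedding.
exact: (@continuous_comp _ _ _ f (fun y : {ptws J -> R} => y j) x (cf x)
  (@ptws_eval_continuous J R j (f x))).
Qed.

Lemma conical_closed : closed (conical faces).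
Proof.
have -> : conical faces = \bigcup_(S in [set S | faces S])
    [set y : {ptws J -> R} | (forall j, 0 <= y j) /\ forall j, j \notin S -> y j = 0].
  apply/seteqP; split=> y /=.
    move=> [y0 yS]; exists (carrier y) => //; split=> // j.
    by rewrite inE negbK => /eqP.
  move=> [S /= fS [y0 yS]]; split=> //; apply: faces_down fS.
  apply/fintype.subsetP => j; rewrite inE; apply: contraR => /yS ->; exact: eqxx.
apply: closed_bigcup => [|S _]; first exact: finite_finset.
have -> : [set y : {ptws J -> R} | (forall j, 0 <= y j) /\
      forall j, j \notin S -> y j = 0] =
    \bigcap_j ((fun y : {ptws J -> R} => y j) @^-1`
      (if j \in S then [set t | 0 <= t] else [set 0])).
  apply/seteqP; split=> [y [y0 yS] j _ /=|y yS].
    by case: ifPn => jS /=; [exact: y0|exact: yS].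
  split=> j; last by move=> /negbTE jS; have := yS j I; rewrite /= jS.
  by have := yS j I; rewrite /=; case: ifP => _ //= ->.
apply: closed_bigI => j _; apply: closed_comp => [y _|].
  exact: ptws_eval_continuous.
by case: ifP => _; [exact: closed_ge | exact: closed_eq].
Qed.

Let box (M : R) : set {ptws J -> R} := [set y | forall j, y j \in `[0, M]].

(** The sublevel sets exhaust X, so that their complements are a basis of
    neighborhoods of infinity. *)
Lemma sublevel_compact (M : R) : compact [set x | forall j, f x j <= M].
Proof.
have -> : [set x | forall j, f x j <= M] =
    f @^-1` (conical faces `&` box M).
  apply/seteqP; split=> x /=.
    move=> xM; split; first exact: chart_conical.
    by move=> j; rewrite in_itv/= xM andbT; have [] := chart_conical x.
  by move=> [_ xM] j; have := xM j; rewrite in_itv/= => /andP[].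
apply: embedding_compact_preimage => //; last first.
  by rewrite f_range; exact: subIsetl.
apply: (@subclosed_compact _ _ (box M)).
- apply: closedI; first exact: conical_closed.
  have -> : box M =
      \bigcap_j ((fun y : {ptws J -> R} => y j) @^-1` `[0, M]%classic).
    by apply/seteqP; split=> [y yM j _|y yM j]; [exact: yM|exact: (yM j I)].
  apply: closed_bigI => j _; apply: closed_comp => [y _|].
    exact: ptws_eval_continuous.
  exact: itv_closed.
- exact: (@tychonoff J (fun=> R) (fun=> `[0, M]%classic)
    (fun=> @segment_compact R 0 M)).
- exact: subIsetr.
Qed.

Lemma conical_hausdorff : hausdorff_space X.
Proof.
have [cf fI _] := f_embedding => p q pq; apply: fI.
apply: (ptws_hausdorff (@Rhausdorff R)) => A B /cf fA /cf fB.
by have [x [Ax Bx]] := pq _ _ fA fB; exists (f x).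
Qed.

Lemma sublevel_closed (M : R) : closed [set x | forall j, f x j <= M].
Proof. by apply: compact_closed; [exact: conical_hausdorff|exact: sublevel_compact]. Qed.

Lemma compact_sub_sublevel (K : set X) :
  compact K -> exists M, K `<=` [set x | forall j, f x j <= M].
Proof.
move=> cK; have bd j : exists M, forall x, K x -> f x j <= M.
  have := @continuous_compact _ _ (fun x => f x j : R^o) K
    (continuous_subspaceT (@chart_coord_continuous j)) cK.
  move=> /compact_bounded[M [_ bM]]; exists (M + 1) => x Kx.
  apply: le_trans (ler_norm _) _; apply: (bM (M + 1)); last by exists x.
  by rewrite ltrDl.
have [M_ bM] := choice bd; exists (\sum_j `|M_ j|) => x Kx j.
apply: le_trans (bM j x Kx) _; apply: le_trans (ler_norm _) _.
by rewrite (bigD1 j)//= lerDl sumr_ge0.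
Qed.

Lemma conical_plus_hausdorff : hausdorff_space Xplus.
Proof.
have sep x : ~ cluster (nbhs (Some x : Xplus)) None.
  pose M := \sum_j f x j + 1.
  have fxM j : f x j < M.
    rewrite /M (bigD1 j)//= -addrA ltrDl ltr_wpDl//.
    by apply: sumr_ge0 => i _; have [] := chart_conical x.
  move=> /(_ (Some @` [set x' | forall j, f x' j < M])
    ((Some @` (~` [set x' | forall j, f x' j <= M])) `|` [set None])).
  case.
  - apply: one_point_compactification_some_nbhs.
    apply: filter_forall => j; apply: (@chart_coord_continuous j x [set t | t < M]).
    by apply: open_nbhs_nbhs; split; [exact: open_lt|exact: fxM].
  - exists [set x' | forall j, f x' j <= M] => //; split.
      exact: sublevel_compact.
    exact: sublevel_closed.
  - move=> z [[x' x'M <-] [[x'' nx'' [xx]]|//]]; apply: nx'' => j.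
    by rewrite xx ltW.
move=> [p|] [q|] //.
- move=> pq; congr Some; apply: conical_hausdorff => A B pA qB.
  have [_ [[a Aa <-] [b Bb [ba]]]] := pq _ _
    (one_point_compactification_some_nbhs _ _ pA)
    (one_point_compactification_some_nbhs _ _ qB).
  by exists a; split=> //; rewrite -ba.
- by move=> /sep.
- by move=> pq; case: (sep q) => A B qA nB; rewrite setIC; exact: pq.
Qed.

Definition conical_inv (y : {ptws J -> R}) : Xplus :=
  if pselect (exists x, f x = y) is left h then Some (projT1 (cid h)) else None.

Lemma conical_invK x : conical_inv (f x) = Some x.
Proof.
rewrite /conical_inv; case: pselect => [h|]; last by case; exists x.
by congr Some; have [_ fI _] := f_embedding; apply: fI; case: (cid h).
Qed.

Lemma conical_invP y : conical faces y -> exists2 x, f x = y & conical_inv y = Some x.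
Proof.
by rewrite -f_range => -[x _ <-]; exists x => //; exact: conical_invK.
Qed.

Definition cone_map (S : {set J}) (x : set_type (disk R #|S|)) : Xplus :=
  if pole_dist (\val x) == 0 then None
  else conical_inv (extend (orthant (\val x))).

Lemma disk_sqnorm k (x : set_type (disk R k)) : sqnorm (\val x) <= 1.
Proof. by case: x => x /= /set_mem. Qed.

Lemma disk_compact k : compact [set: set_type (disk R k)].
Proof.
apply: compact_set_type.
apply: (@subclosed_compact _ _
  [set x : 'rV[R]_k | forall i, `[-1, 1]%classic (x ord0 i)]).
- apply: (@closed_comp _ _ (@sqnorm R k) [set t | t <= 1]) => [x _|].
    exact: sqnorm_continuous.
  exact: closed_le.
- apply: (@rV_compact R k (fun=> `[-1, 1]%classic)) => _.
  exact: segment_compact.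
- move=> x /= x1 i; rewrite in_itv/= -ler_norml.
  rewrite -(@ler_pXn2r _ 2) ?nnegrE// expr1n real_normK ?num_real//.
  apply: le_trans x1; rewrite (bigD1 i)//= lerDl sumr_ge0// => l _.
  exact: sqr_ge0.
Qed.

Section Cone.
Variables (S : {set J}) (fS : faces S).

Lemma cone_mapP (x : set_type (disk R #|S|)) : pole_dist (\val x) != 0 ->
  exists2 z, f z = extend (orthant (\val x)) & cone_map x = Some z.
Proof.
move=> /negbTE Q0; rewrite /cone_map Q0; apply: conical_invP.
split; last exact: faces_down (carrier_extend_sub _) fS.
by apply: extend_ge0 => i; apply: orthant_ge0; exact: disk_sqnorm.
Qed.

Lemma cone_map_continuous : continuous (@cone_map S).
Proof.
have cv : continuous (fun x : set_type (disk R #|S|) => \val x).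
  exact: initial_continuous.
have cQ : continuous (fun x : set_type (disk R #|S|) => pole_dist (\val x)).
  by move=> x; apply: continuous_comp; [exact: cv|exact: pole_dist_continuous].
move=> x; rewrite /continuous_at; have [Q0|Qn] := eqVneq (pole_dist (\val x)) 0.
  have -> : cone_map x = None by rewrite /cone_map Q0 eqxx.
  move=> A [K [cK _] KA].
  have [M KM] := compact_sub_sublevel cK.
  have [e e0 He] := orthant_unbounded #|S| M.
  have xe : \forall z \near x, pole_dist (\val z) < e.
    by apply: (cQ x [set t | t < e]); apply: open_nbhs_nbhs; split; [exact: open_lt|rewrite /= Q0].
  apply: (@filterS _ _ (nbhs_filter x) _ _ _ xe) => z /= ze; apply: KA.
  have [z0|zn] := eqVneq (pole_dist (\val z)) 0.
    by right; rewrite /cone_map z0 eqxx.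
  have [w fw ->] := cone_mapP zn; left; exists w => // /KM /= wM.
  have [||i] := He (\val z); first exact: disk_sqnorm.
    by rewrite ze andbT lt_def zn pole_dist_ge0.
  by rewrite -extend_val -fw ltNge wM.
have [w fw xw] := cone_mapP Qn; rewrite xw => A /= wA.
have [cf fI fopen] := f_embedding.
have : nbhs w (Some @^-1` A) by exact: wA.
rewrite nbhsE => -[U [oU Uw] UA].
have [V oV VU] := fopen U oU.
have Vx : nbhs (extend (orthant (\val x))) V.
  have : (f @^-1` V) w by rewrite VU.
  by rewrite /= fw => Vw; apply: open_nbhs_nbhs.
have co : {for x, continuous (fun z : set_type (disk R #|S|) =>
    extend (orthant (\val z)))}.
  apply: ptws_continuous_at => j; apply: sum_continuous_at => i _.
  apply: (@continuous_comp _ _ _ (fun z : set_type (disk R #|S|) => \val z)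
    (fun z => orthant z i)); first exact: cv.
  by apply: orthant_continuous; rewrite lt_def Qn pole_dist_ge0.
have H1 : \forall z \near x, V (extend (orthant (\val z))) by exact: co.
have H2 : \forall z \near x, pole_dist (\val z) != 0.
  have xp : \forall z \near x, 0 < pole_dist (\val z).
    apply: (cQ x [set t | 0 < t]); apply: open_nbhs_nbhs; split; first exact: open_gt.
    by rewrite /= lt_def Qn pole_dist_ge0.
  apply: (@filterS _ _ (nbhs_filter x) _ _ _ xp) => z.
  by rewrite lt_def => /andP[].
apply: (@filterS2 _ _ (nbhs_filter x) _ _ _ _ H1 H2) => z Vz zn /=.
have [w' fw' ->] := cone_mapP zn; apply: UA; rewrite -VU /=.
by rewrite fw'.
Qed.

Lemma cone_map_inj : injective (@cone_map S).
Proof.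
move=> x y; have [x0|xn] := eqVneq (pole_dist (\val x)) 0;
    have [y0|yn] := eqVneq (pole_dist (\val y)) 0.
- by move=> _; apply/val_inj/pole_inj.
- by have [w _ ->] := cone_mapP yn; rewrite /cone_map x0 eqxx.
- by have [w _ ->] := cone_mapP xn; rewrite /cone_map y0 eqxx.
have [w fw ->] := cone_mapP xn; have [w' fw' ->] := cone_mapP yn.
move=> [ww]; apply/val_inj/orthant_inj.
- by rewrite lt_def xn pole_dist_ge0.
- by rewrite lt_def yn pole_dist_ge0.
by move=> i; rewrite -!extend_val -fw -fw' ww.
Qed.

Lemma cone_map_interior (x : X) :
  (@cone_map S @` disk_interior R #|S|) (Some x) <-> carrier (f x) = S.
Proof.
split.
  move=> [p p1]; have p0 := interior_pole_dist_gt0 p1.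
  have [w fw ->] := cone_mapP (lt0r_neq0 p0); move=> [<-].
  apply/eqP; rewrite fw carrier_extend; apply/forallP => i.
  by rewrite gt_eqF// orthant_gt0.
move=> SE; have [x0 _] := chart_conical x.
have [p [p1 Qp op]] := orthant_surj (fun i : 'I_#|S| => x0 (enum_val i)).
have fE : f x = extend (orthant p).
  apply/funext => j; have [jS|jS] := boolP (j \in S).
    by rewrite -(enum_rankK_in jS jS) extend_val op.
  by rewrite extend_out//; move: jS; rewrite -SE inE negbK => /eqP.
have pD : p \in disk R #|S| by apply/mem_set.
exists (exist _ p pD).
  rewrite /disk_interior /= lt_neqAle; apply/andP; split=> //.
  apply/eqP => /orthant_boundary[i].
  rewrite op => fi0.
  have : enum_val i \in carrier (f x) by rewrite SE enum_valP.
  by rewrite inE fi0 eqxx.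
by rewrite /cone_map /= gt_eqF// -fE conical_invK.
Qed.

Lemma cone_map_boundary (p : set_type (disk R #|S|)) :
  ~ disk_interior R #|S| p -> (0 < #|S|)%N /\
  (cone_map p = None \/
   exists2 x, cone_map p = Some x & carrier (f x) \proper S).
Proof.
move=> np; have p1 : sqnorm (\val p) = 1.
  apply/eqP; rewrite eq_le disk_sqnorm/= leNgt; apply/negP => p1; exact: np.
have [i oi] := orthant_boundary p1.
split; first by apply: leq_ltn_trans (ltn_ord i).
have [p0|pn] := eqVneq (pole_dist (\val p)) 0.
  by left; rewrite /cone_map p0 eqxx.
right; have [w fw pw] := cone_mapP pn; exists w => //.
rewrite finset.properEneq fw carrier_extend_sub andbT carrier_extend.
by apply/forallPn; exists i; rewrite oi eqxx.
Qed.

End Cone.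

Let cell_type : finType := option {S : {set J} | faces S}.

Let cell_dimension (c : cell_type) : nat :=
  if c is Some F then #|val F| else 0%N.

Let cell_map (c : cell_type) : set_type (disk R (cell_dimension c)) -> Xplus :=
  match c return set_type (disk R (cell_dimension c)) -> Xplus with
  | Some F => @cone_map (val F)
  | None => fun=> None
  end.

Let cell_map_continuous c : continuous (@cell_map c).
Proof.
case: c => [[S fS]|]; first exact: (cone_map_continuous fS).
exact: (@cst_continuous _ Xplus None).
Qed.

Let cell_map_inj c : injective (@cell_map c).
Proof.
case: c => [[S fS]|]; first exact: (cone_map_inj fS).
by move=> x y _; apply/val_inj/rowP => -[].
Qed.

Let cell_map_interior c (x : X) :
  (@cell_map c @` disk_interior R (cell_dimension c)) (Some x) <->
  exists2 S, c = Some S & carrier (f x) = val S.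
Proof.
case: c => [[S fS]|] /=.
  split=> [/(cone_map_interior fS) SE|[_ [<-] /(cone_map_interior fS)//]].
  by exists (exist _ S fS).
by split=> -[].
Qed.

Let point_at_infinity :
  (@cell_map None @` disk_interior R (cell_dimension None)) None.
Proof.
have D0 : (0 : 'rV[R]_0) \in disk R 0 by apply/mem_set; rewrite /disk/= big_ord0.
by exists (exist _ 0 D0) => //; rewrite /disk_interior /= big_ord0.
Qed.

Let cell_map_infinity c :
  (@cell_map c @` disk_interior R (cell_dimension c)) None -> c = None.
Proof.
case: c => [[S fS]|//] /= -[p p1].
have p0 := interior_pole_dist_gt0 p1.
by have [w _ ->] := cone_mapP fS (lt0r_neq0 p0).
Qed.

Let cell_partition (x : Xplus) :
  exists! c, (@cell_map c @` disk_interior R (cell_dimension c)) x.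
Proof.
case: x => [x|].
  have [_ fx] := chart_conical x; exists (Some (exist _ (carrier (f x)) fx)).
  split; first by apply/cell_map_interior; exists (exist _ (carrier (f x)) fx).
  by move=> c /cell_map_interior[S -> SE]; congr Some; apply/val_inj.
by exists None; split=> [|c /cell_map_infinity ->//]; exact: point_at_infinity.
Qed.

Let cell_boundary c (p : set_type (disk R (cell_dimension c))) :
  ~ disk_interior R (cell_dimension c) p ->
  exists c', (cell_dimension c' < cell_dimension c)%N /\
    (@cell_map c' @` disk_interior R (cell_dimension c')) (cell_map p).
Proof.
case: c p => [[S fS]|] p np /=.
  have [S0 [->|[x -> xS]]] := cone_map_boundary fS np.
    by exists None; split=> //; exact: point_at_infinity.
  have [_ fx] := chart_conical x; exists (Some (exist _ (carrier (f x)) fx)).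
  split; first exact: proper_card.
  by apply/cell_map_interior; exists (exist _ (carrier (f x)) fx).
by case: np; rewrite /disk_interior /= big_ord0.
Qed.

Let cell_weak_topology (A : set Xplus) :
  (forall c, closed (@cell_map c @^-1` A)) -> closed A.
Proof.
move=> clA.
have -> : A = \bigcup_c (@cell_map c @` (@cell_map c @^-1` A)).
  apply/seteqP; split=> [x Ax|x [c _ [p Ap <-]]//].
  have [c [[p _ px] _]] := cell_partition x.
  by exists c => //; exists p => //=; rewrite px.
apply: closed_bigcup => [|c _]; first exact: finite_finset.
apply/(compact_closed conical_plus_hausdorff)/continuous_compact.
  exact/continuous_subspaceT/cell_map_continuous.
apply: subclosed_compact (@disk_compact _) _ => //; exact: clA.
Qed.

(** The cells are the open orthants indexed by the faces, the empty face giving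
    the apex, together with the point at infinity. *)
Theorem conical_complex : exists K : finite_cw R Xplus,
  cw_regular K /\ cw_dim K = (\max_(S | faces S) #|S|)%N.
Proof.
exists (FiniteCW conical_plus_hausdorff cell_map_continuous
  (fun c => in2W (@cell_map_inj c)) cell_partition cell_boundary
  cell_weak_topology); split.
  move=> c; apply: compact_injective_embedding.
  - exact: disk_compact.
  - exact: conical_plus_hausdorff.
  - exact: cell_map_continuous.
  - exact: cell_map_inj.
rewrite /cw_dim /=; apply/eqP; rewrite eqn_leq; apply/andP; split.
  apply/bigmax_leqP => -[[S fS]|] _ //=.
  exact: (@leq_bigmax_cond _ faces (fun S : {set J} => #|S|) S).
apply/bigmax_leqP => S fS.
exact: (@leq_bigmax _ (fun c : cell_type => cell_dimension c)
  (Some (exist _ S fS))).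
Qed.

End ConicalComplex.

(** * The fan of the braid arrangement *)

Section BraidFan.
Context (R : realType) (I : finType).
Implicit Types (x : I -> R) (A B : {set I}) (y : {set I} -> R).

(** The proper sets of the form {x > c}; they form a chain. *)
Definition levels x : {set {set I}} :=
  [set A | [&& A != finset.set0, A != [set: I] &
    [forall i in A, forall j in ~: A, x j < x i]]]%SET.

(** The least drop of x from A to its complement, or 0 if x does not drop
    everywhere.  The default value of the minimum is at least all differences
    and makes the expression continuous in x. *)
Definition gap x A : R :=
  if (A == finset.set0) || (A == [set: I]%SET) then 0
  else Num.max 0 (\big[Num.min/(\sum_(p : I * I) `|x p.1 - x p.2|)]_(p : I * I |
    (p.1 \in A) && (p.2 \notin A)) (x p.1 - x p.2)).

Definition layer y (i : I) : R := \sum_(A : {set I} | i \in A) y A.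

Lemma levelsP x A : reflect
  [/\ A != finset.set0, A != [set: I]%SET &
      forall i j, i \in A -> j \notin A -> x j < x i] (A \in levels x).
Proof.
rewrite inE; apply: (iffP and3P) => -[A0 AT H]; split=> //.
  move=> i j iA jA; have /forallP/(_ i)/implyP/(_ iA) := H.
  by move=> /forallP/(_ j)/implyP; apply; rewrite inE.
apply/forallP => i; apply/implyP => iA; apply/forallP => j.
by apply/implyP; rewrite inE => jA; exact: H.
Qed.

Lemma proper_pair A : A != finset.set0 -> A != [set: I]%SET ->
  exists i j, (i \in A) && (j \notin A).
Proof.
move=> /set0Pn[i iA] AT.
have /existsP[j jA] : [exists j, j \notin A].
  apply: contraR AT; rewrite negb_exists => /forallP AT.
  by apply/eqP/setP => j; have := AT j; rewrite negbK inE => ->.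
by exists i, j; rewrite iA.
Qed.

Lemma gap_le x A i j : i \in A -> j \notin A -> gap x A <= Num.max 0 (x i - x j).
Proof.
move=> iA jA; rewrite /gap; case: ifP => _; first by rewrite le_max lexx.
rewrite ge_max !le_max lexx/=; apply/orP; right.
by apply: (bigmin_inf (i, j)); rewrite /= ?iA.
Qed.

Lemma gap_attained x A : A != finset.set0 -> A != [set: I]%SET ->
  exists i j, [/\ i \in A, j \notin A & gap x A = Num.max 0 (x i - x j)].
Proof.
move=> A0 AT; rewrite /gap (negbTE A0) (negbTE AT)/=.
have [i [j /andP[iA jA]]] := proper_pair A0 AT.
set m := \big[_/_]_(_ | _) _.
have [mD|[[k l] /= /andP[kA lA] mF]] := bigmin_mem
    (fun p : I * I => (p.1 \in A) && (p.2 \notin A))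
    (\sum_(p : I * I) `|x p.1 - x p.2|) (fun p => x p.1 - x p.2).
  exists i, j; split=> //; congr Num.max; apply: le_anti; apply/andP; split.
    by apply: (bigmin_inf (i, j)); rewrite /= ?iA.
  rewrite /m mD (bigD1 (i, j))//=; apply: le_trans (ler_norm _) _.
  by rewrite lerDl sumr_ge0.
by exists k, l; rewrite /m mF.
Qed.

Lemma gap_ge0 x A : 0 <= gap x A.
Proof. by rewrite /gap; case: ifP => // _; rewrite le_max lexx. Qed.

Lemma carrier_gap x : carrier (gap x) = levels x.
Proof.
apply/setP => A; rewrite [LHS]inE; apply/idP/levelsP.
  move=> gA; have /andP[A0 AT] : (A != finset.set0) && (A != [set: I]%SET).
    by rewrite -negb_or; apply: contraNN gA => AE; rewrite /gap AE.
  split=> // i j iA jA; rewrite -subr_gt0.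
  have : 0 < gap x A by rewrite lt_def gA gap_ge0.
  by move/lt_le_trans => /(_ _ (gap_le x iA jA)); rewrite lt_max ltxx.
move=> [A0 AT H]; have [i [j [iA jA ->]]] := gap_attained x A0 AT.
by rewrite gt_eqF// lt_max subr_gt0 H ?orbT.
Qed.

Lemma gap_translation x x' :
  (forall i j, x i - x j = x' i - x' j) -> gap x =1 gap x'.
Proof.
move=> xx A; rewrite /gap; case: ifP => // _; congr Num.max.
have -> : \sum_(p : I * I) `|x p.1 - x p.2| = \sum_(p : I * I) `|x' p.1 - x' p.2|.
  by apply: eq_bigr => p _; rewrite xx.
by apply: eq_bigr => p _; exact: xx.
Qed.

Lemma layer_sub y i j : layer y i - layer y j =
  \sum_(B : {set I} | (i \in B) && (j \notin B)) y B -
  \sum_(B : {set I} | (j \in B) && (i \notin B)) y B.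
Proof.
rewrite /layer (bigID (fun B : {set I} => j \in B))/=.
rewrite [X in _ - X](bigID (fun B : {set I} => i \in B))/=.
rewrite (eq_bigl (fun B : {set I} => (j \in B) && (i \in B))) => [|B].
  by rewrite opprD addrACA addrN add0r.
exact: andbC.
Qed.

(** Evaluated at a point i of A where x is least and a point j outside A where x
    is greatest, the sum drops by at most y A, because A is the only set of the
    chain that contains i but not j.  Conversely, when A belongs to the chain,
    every drop from A to its complement is at least y A, because the sets of the
    chain that contain a point outside A contain all of A. *)
Lemma gap_layer x y : (forall A, 0 <= y A) -> carrier y \subset levels x ->
  gap (layer y) =1 y.
Proof.
move=> y0 yx A.
have ylev B : B \notin levels x -> y B = 0.
  by move=> Bx; apply/eqP; apply: contraNT Bx => yB;
    apply: (fintype.subsetP yx); rewrite inE.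
have [AE|] := boolP ((A == finset.set0) || (A == [set: I]%SET)).
  rewrite /gap AE ylev//; apply/negP => /levelsP[A0 AT _].
  by move: AE; rewrite (negbTE A0) (negbTE AT).
rewrite negb_or => /andP[A0 AT]; apply: le_anti; apply/andP; split.
  have [a [b /andP[aA bA]]] := proper_pair A0 AT.
  case: (@arg_minP _ _ _ a (fun k => k \in A) x aA) => i iA xi.
  case: (@arg_maxP _ _ _ b (fun j => j \notin A) x bA) => j jA xj.
  apply: le_trans (gap_le _ iA jA) _; rewrite ge_max y0/= layer_sub.
  rewrite (bigD1 A)/=; last by rewrite iA.
  rewrite [X in _ + X - _]big1 => [|B /andP[/andP[iB jB] BA]].
    by rewrite addr0 gerBl sumr_ge0.
  apply: ylev; apply/negP => /levelsP[_ _ H]; move/negP: BA; apply.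
  rewrite finset.eqEsubset; apply/andP; split; apply/fintype.subsetP => k kM.
    apply: contraT => kA; have := H k j kM jB; rewrite ltNge.
    by have /= -> := xj k kA.
  apply: contraT => kB; have := H i k iB kB; rewrite ltNge.
  by have /= -> := xi k kM.
have [->|yA] := eqVneq (y A) 0; first exact: gap_ge0.
have /levelsP[_ _ HA] : A \in levels x by apply: contraNT yA => /ylev ->.
have [i [j [iA jA ->]]] := gap_attained (layer y) A0 AT.
rewrite le_max; apply/orP; right; rewrite layer_sub.
rewrite [X in _ - X]big1 => [|B /andP[jB iB]].
  by rewrite subr0 (bigD1 A)/= ?iA// lerDl sumr_ge0.
apply: ylev; apply/negP => /levelsP[_ _ HB].
by have := lt_trans (HA i j iA jA) (HB j i jB iB); rewrite ltxx.
Qed.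

(** Induction on the number of points where x is not maximal: lowering the top
    level of x to the next one leaves a function with fewer such points, and its
    levels are also levels of x. *)
Lemma layer_exists x : exists y, [/\ forall A, 0 <= y A,
  carrier y \subset levels x & forall i j, x i - x j = layer y i - layer y j].
Proof.
have [n] := ubnP #|[set i | [exists j, x i < x j]]%SET|.
elim: n x => // n IH x; set N := [set i | _]%SET => Nn.
have [N0|/set0Pn[k0 k0N]] := eqVneq N finset.set0.
  exists (fun=> 0); split=> [//||i j].
    by apply/fintype.subsetP => A; rewrite inE eqxx.
  rewrite /layer !big1// subrr; apply/eqP; rewrite subr_eq0.
  have eqx a b : x a <= x b.
    rewrite leNgt; apply/negP => ba; have : b \in N.
      by rewrite inE; apply/existsP; exists a.
    by rewrite N0 inE.
  by rewrite eq_le !eqx.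
case: (@arg_maxP _ _ _ k0 (fun l => l \in N) x k0N) => k /= kN xk0.
have xk i : i \in N -> x i <= x k by exact: xk0.
case: (@arg_maxP _ _ _ k0 xpredT x isT) => a _ xa0.
have xa i : x i <= x a by exact: xa0.
have NP i : (i \in N) = (x i < x a).
  rewrite inE; apply/existsP/idP => [[j xij]|xia]; last by exists a.
  exact: lt_le_trans xij (xa j).
have eqA i : i \notin N -> x i = x a.
  by rewrite NP -leNgt => ai; apply: le_anti; rewrite ai xa.
have ka : x k < x a by rewrite -NP.
pose x' i := if i \in N then x i else x k.
have x'k i : x' i <= x k by rewrite /x'; case: ifP => // iN; exact: xk.
have AN : (~: N)%SET \in levels x.
  apply/levelsP; split=> [||i j].
  - by apply/set0Pn; exists a; rewrite finset.in_setC NP ltxx.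
  - by apply/eqP => /setP/(_ k); rewrite finset.in_setC kN finset.in_setT.
  - by rewrite !finset.in_setC negbK => /eqA ->; rewrite NP.
have lev' B : B \in levels x' -> B \in levels x.
  move=> /levelsP[B0 BT HB]; apply/levelsP; split=> // i j iB jB.
  have := HB i j iB jB; rewrite /x'; case: ifPn => jN; case: ifPn => iN //.
    by move=> _; rewrite (eqA i iN) -NP.
    by move=> /lt_geF; rewrite xk.
  by rewrite ltxx.
have [|y [y0 yx yE]] := IH x'.
  rewrite -ltnS; apply: leq_trans Nn; rewrite ltnS; apply: proper_card.
  apply/fintype.properP; split; last first.
    exists k => //; rewrite inE; apply/existsP => -[j].
    by rewrite {1}/x' kN ltNge x'k.
  apply/fintype.subsetP => i; rewrite inE => /existsP[j].
  by rewrite {1}/x'; case: ifP => // _; rewrite ltNge x'k.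
pose d := x a - x k.
have d0 : 0 < d by rewrite subr_gt0.
exists (fun B => y B + if B == (~: N)%SET then d else 0); split.
- by move=> B; rewrite addr_ge0//; case: ifP => // _; exact: ltW.
- apply/fintype.subsetP => B; have [->//|BN] := eqVneq B (~: N)%SET.
  by rewrite inE (negbTE BN) addr0 => yB; apply/lev'/(fintype.subsetP yx); rewrite inE.
have lE i : layer (fun B => y B + if B == (~: N)%SET then d else 0) i =
    layer y i + if i \in N then 0 else d.
  rewrite /layer big_split/=; congr (_ + _).
  rewrite -big_mkcondr/=; case: ifPn => iN.
    by rewrite big_pred0// => B; apply/andP => -[iB /eqP BE];
      rewrite BE finset.in_setC iN in iB.
  rewrite (big_pred1 (~: N)%SET)// => B /=; case: eqP => [->|]; last by rewrite andbF.
  by rewrite finset.in_setC iN.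
move=> i j; rewrite !lE; have := yE i j; rewrite /x' /d.
by case: ifPn => iN; case: ifPn => jN;
  rewrite ?(eqA _ iN) ?(eqA _ jN) => ?; lra.
Qed.

Lemma layer_gap x i j : layer (gap x) i - layer (gap x) j = x i - x j.
Proof.
have [y [y0 yx yE]] := layer_exists x.
rewrite yE; have -> // : gap x = y.
by apply/funext => A; rewrite (gap_translation yE) (gap_layer y0 yx).
Qed.

Definition above x (i : I) : {set I} := [set j | x i <= x j]%SET.

Lemma above_eq x i j : (above x i == above x j) = (x i == x j).
Proof.
apply/eqP/eqP => [/setP E|E]; last by apply/setP => k; rewrite !inE E.
by apply: le_anti; have := E i; have := E j; rewrite !inE !lexx => -> <-.
Qed.

Lemma above_level x i j : x j < x i -> above x i \in levels x.
Proof.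
move=> ji; apply/levelsP; split=> [||k l].
- by apply/set0Pn; exists i; rewrite inE.
- by apply/eqP => /setP/(_ j); rewrite !inE leNgt ji.
- by rewrite !inE -ltNge => ik li; exact: lt_le_trans ik.
Qed.

Lemma levels_lt x x' : levels x \subset levels x' ->
  forall i j, x j < x i -> x' j < x' i.
Proof.
move=> /fintype.subsetP xx i j ji.
have /xx/levelsP[_ _] := above_level ji; apply; first by rewrite inE.
by rewrite inE -ltNge.
Qed.

Lemma levels_order x x' : levels x = levels x' ->
  forall i j, (x i <= x j) = (x' i <= x' j).
Proof.
move=> xx i j; rewrite !leNgt; congr negb; apply/idP/idP.
  by apply: levels_lt; rewrite xx.
by apply: levels_lt; rewrite xx.
Qed.

(** The sets {x >= x i} are the levels and the full set. *)
Lemma levels_above x (i0 : I) : #|levels x|.+1 = #|above x @: [set: I]%SET|.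
Proof.
case: (@arg_minP _ _ _ i0 xpredT x isT) => a _ xa.
have aT : above x a = [set: I]%SET by apply/setP => i; rewrite !inE xa.
have -> : above x @: [set: I]%SET = ([set: I] |: levels x)%SET.
  apply/setP => A; apply/imsetP/setU1P => [[i _ ->]|[->|Ax]].
  - have [ai|ia] := ltP (x a) (x i); first by right; exact: above_level ai.
    left; rewrite -aT; apply/eqP; rewrite above_eq eq_le ia; exact: xa.
  - by exists a.
  have /levelsP[/set0Pn[k kA] _ HA] := Ax.
  case: (@arg_minP _ _ _ k (fun l => l \in A) x kA) => i iA xi; exists i => //.
  apply/setP => j; rewrite inE; apply/idP/idP => [jA|]; first exact: xi.
  by apply: contraTT => jA; rewrite -ltNge HA.
rewrite cardsU1; suff -> : [set: I]%SET \notin levels x by [].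
by apply/negP => /levelsP[_ /eqP].
Qed.

Lemma gap_continuous (T : topologicalType) (x : T -> I -> R) (t : T) A :
  (forall i, {for t, continuous (fun s => x s i)}) ->
  {for t, continuous (fun s => gap (x s) A)}.
Proof.
move=> cx; rewrite /gap; case: (_ || _); first exact: cst_continuous_at.
have cp (p : I * I) : {for t, continuous (fun s => x s p.1 - x s p.2)}.
  exact: sub_continuous_at.
apply: continuous_max; first exact: cst_continuous_at.
apply: bigmin_continuous => //; apply: sum_continuous_at => p _.
exact: (cvg_norm (cp p)).
Qed.

Lemma layer_continuous i : continuous (fun y : {ptws {set I} -> R} => layer y i).
Proof.
by move=> y; apply: sum_continuous_at => A _; exact: ptws_eval_continuous.
Qed.

End BraidFan.

(** * Unions of cells of parameters *)

Section DiscriminantCells.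
Context (R : realType) (G : graph).

Local Notation params := (params R G).
Local Notation index := (option (gV G + gE G)).

(** The extra index, with value 0, records the position of 0 among the values of
    E and W; this is what makes the cones pointed. *)
Definition coords (x : params) (i : index) : R :=
  match i with
  | None => 0
  | Some (inl v) => x.1 v
  | Some (inr e) => x.2 e
  end.

Definition fan_coords (x : params) : {ptws {set index} -> R} := gap (coords x).

Definition of_fan (y : {ptws {set index} -> R}) : params :=
  (fun v => layer y (Some (inl v)) - layer y None,
   fun e => layer y (Some (inr e)) - layer y None).

Lemma params_continuous (T : topologicalType) (f : T -> params) (t : T) :
  (forall v, {for t, continuous (fun s => (f s).1 v)}) ->
  (forall e, {for t, continuous (fun s => (f s).2 e)}) ->
  {for t, continuous f}.
Proof.
move=> c1 c2.
have f1 : {for t, continuous (fun s => (f s).1 : {ptws gV G -> R})}.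
  exact: ptws_continuous_at.
have f2 : {for t, continuous (fun s => (f s).2 : {ptws gE G -> R})}.
  exact: ptws_continuous_at.
have -> : f = fun s => ((f s).1, (f s).2) by apply/funext => s; case: (f s).
exact: (cvg_pair f1 f2).
Qed.

Lemma coords_continuous i : continuous (fun x => coords x i).
Proof.
case: i => [[v|e]|] x; last exact: cst_continuous_at.
  apply: (@continuous_comp _ _ _ (fun x : params => x.1 : {ptws gV G -> R})
    (fun g : {ptws gV G -> R} => g v)); last exact: ptws_eval_continuous.
  exact: cvg_fst.
apply: (@continuous_comp _ _ _ (fun x : params => x.2 : {ptws gE G -> R})
  (fun g : {ptws gE G -> R} => g e)); last exact: ptws_eval_continuous.
exact: cvg_snd.
Qed.

Lemma fan_coords_continuous : continuous fan_coords.
Proof.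
move=> x; apply: ptws_continuous_at => A; apply: gap_continuous => i.
exact: coords_continuous.
Qed.

Lemma of_fan_continuous : continuous of_fan.
Proof.
move=> y; apply: params_continuous => i;
  by apply: sub_continuous_at; exact: layer_continuous.
Qed.

Lemma coords_of_fan y i j :
  coords (of_fan y) i - coords (of_fan y) j = layer y i - layer y j.
Proof. by case: i => [[v|e]|]; case: j => [[w|g]|] /=; lra. Qed.

Lemma fan_coordsK : cancel fan_coords of_fan.
Proof.
by move=> [E W]; rewrite /of_fan /fan_coords; congr pair;
  apply/funext => i; rewrite layer_gap subr0.
Qed.

Lemma of_fanK (y : {ptws {set index} -> R}) (x : params) :
  (forall A, 0 <= y A) -> carrier y \subset levels (coords x) ->
  fan_coords (of_fan y) = y.
Proof.
move=> y0 yx; apply/funext => A; rewrite /fan_coords.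
rewrite (gap_translation (coords_of_fan y)); exact: gap_layer y0 yx A.
Qed.

Definition same_order (x x' : params) : Prop :=
  forall i j, (coords x i <= coords x j) = (coords x' i <= coords x' j).

Lemma has_height_order h (x x' : params) :
  same_order x x' -> has_height h x -> has_height h x'.
Proof.
move=> xx [h0 h1]; split=> [i|a a'].
  rewrite h0; split=> H j.
    by rewrite -(xx (Some (inl i)) (Some (inl j))); exact: H.
  by have := H j; rewrite -(xx (Some (inl i)) (Some (inl j))).
by rewrite h1; have := xx (Some (inr a)) (Some (inr a')) => /= ->.
Qed.

Lemma good_height h (x x' : params) :
  has_height h x -> has_height h x' -> good_params x -> good_params x'.
Proof.
move=> [h0 h1] [h0' h1'] [[v Uv]|xI].
  left; exists v => u uv.
  have vmin : forall j, x'.1 v <= x'.1 j.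
    apply/h0'/h0 => j; have [->//|jv] := eqVneq j v; exact/ltW/Uv.
  rewrite lt_neqAle vmin andbT; apply/eqP => vu.
  have /h0'/h0/(_ v) : forall j, x'.1 u <= x'.1 j by rewrite -vu.
  by rewrite leNgt Uv.
right=> a a' aa; apply: xI; apply: le_anti; apply/andP.
by split; apply/h1/h1'; rewrite aa.
Qed.

Lemma cell_height h (x x' : params) : cell h x -> has_height h x' -> cell h x'.
Proof.
move=> [bx hx] hx'; split=> // gx'; apply: bx.
exact: good_height hx' hx gx'.
Qed.

Lemma cell_levels h (x x' : params) :
  levels (coords x) = levels (coords x') -> cell h x -> cell h x'.
Proof.
move=> /levels_order xx cx; apply: cell_height (cx) _.
by case: cx => _; exact: has_height_order.
Qed.

(** The distinct values of a point of C(h) are 0, the minimum of E, the values of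
    E at the vertices of height 2 and one value of W for each height; [rep]
    indexes this list. *)
Section CellDimension.
Variable h : height_function G.

Let minimum : gV G := projT1 (cid (height0_min h)).

Let minimumP : height0 h minimum = ord0.
Proof. by rewrite /minimum; case: cid. Qed.

Let edge_of (k : 'I_(height_n h)) : gE G := projT1 (cid (height1_surj k)).

Let edge_ofK k : height1 h (edge_of k) = k.
Proof. by rewrite /edge_of; case: cid. Qed.

Let rep : Type := option ({v | (v == minimum) || (height0 h v != ord0)} +
  'I_(height_n h)).

Let rep_index (r : rep) : index :=
  match r with
  | None => None
  | Some (inl v) => Some (inl (val v))
  | Some (inr k) => Some (inr (edge_of k))
  end.

Let card_rep : #|{: rep}| = (cell_dim h).+1.
Proof.
rewrite /rep card_option card_sum card_ord card_sig /cell_dim; congr (_ + _).+1.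
transitivity #|(minimum |: [set i | height0 h i != ord0])%SET|.
  by apply: eq_card => v; rewrite !inE.
by rewrite cardsU1 inE minimumP eqxx.
Qed.

Lemma cell_values x : has_height h x ->
  forall i, exists r, coords x (rep_index r) = coords x i.
Proof.
move=> [h0 h1] [[v|e]|]; last by exists None.
  have [v0|vn] := eqVneq (height0 h v) ord0.
    exists (Some (inl (exist _ minimum (introT orP (or_introl (eqxx _)))))) => /=.
    apply: le_anti; apply/andP.
    by split; [apply/(h0 minimum).1|apply/(h0 v).1].
  by exists (Some (inl (exist _ v (introT orP (or_intror vn))))).
exists (Some (inr (height1 h e))) => /=.
by apply: le_anti; apply/andP; split; apply/h1; rewrite edge_ofK.
Qed.

Lemma card_levels_cell x : has_height h x ->
  (#|levels (coords x)| <= cell_dim h)%N.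
Proof.
move=> hx; rewrite -ltnS (levels_above _ None) -card_rep.
apply: leq_trans (leq_imset_card (fun r => above (coords x) (rep_index r)) _).
apply/subset_leq_card/fintype.subsetP => A /imsetP[i _ ->].
have [r ri] := cell_values hx i; apply/imsetP; exists r => //.
by apply/eqP; rewrite above_eq ri.
Qed.

(** All the values in the list above are distinct: those of E are negative, those
    of W are positive, and the minimum of E is below the other values, which are
    told apart by the rank of the vertex. *)
Definition generic_point : params :=
  (fun v => if height0 h v == ord0 then - #|gV G|.+1%:R
            else - (enum_rank v).+1%:R,
   fun e => (height1 h e).+1%:R).

Lemma generic_height : has_height h generic_point.
Proof.
split=> [i|a a'] /=; last by rewrite ler_nat ltnS.
split=> [-> j|H].
  rewrite eqxx; case: ifP => // _; rewrite lerN2 ler_nat ltnS.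
  exact/ltnW.
apply/eqP; apply: contraT => /negbTE i0.
have := H minimum; rewrite i0 minimumP eqxx lerN2 ler_nat ltnS.
by rewrite leqNgt ltn_ord.
Qed.

Lemma card_levels_generic : #|levels (coords generic_point)| = cell_dim h.
Proof.
apply/eqP; rewrite eqn_leq (card_levels_cell generic_height)/=.
rewrite -ltnS (levels_above _ None) -card_rep.
rewrite -(card_imset _ (f := fun r => above (coords generic_point) (rep_index r))).
  apply/subset_leq_card/fintype.subsetP => A /imsetP[r _ ->].
  by apply: imset_f.
move=> r s /eqP; rewrite above_eq => /eqP.
have posS n : 0 < n.+1%:R :> R by rewrite ltr0n.
have neg v : coords generic_point (Some (inl v)) < 0.
  by rewrite /=; case: ifP => _; rewrite oppr_lt0.
have pos e : 0 < coords generic_point (Some (inr e)) by [].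
case: r => [[v|k]|]; case: s => [[w|l]|] //= E.
- congr (Some (inl _)); apply/val_inj => /=; move: E.
  case: v w => [v /= /orP[/eqP ->|vn]] [w /= /orP[/eqP ->|wn]] //=.
  + rewrite minimumP eqxx (negbTE wn) => /oppr_inj/eqP; rewrite eqr_nat eqSS.
    by move/eqP => E; have := ltn_ord (enum_rank w); rewrite -E ltnn.
  + rewrite minimumP eqxx (negbTE vn) => /oppr_inj/eqP; rewrite eqr_nat eqSS.
    by move/eqP => E; have := ltn_ord (enum_rank v); rewrite E ltnn.
  rewrite (negbTE vn) (negbTE wn) => /oppr_inj/eqP; rewrite eqr_nat eqSS.
  by move=> /eqP/val_inj/enum_rank_inj.
- by have := neg (val v); rewrite /= E ltNge ltW.
- by have := neg (val v); rewrite /= E ltxx.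
- by have := neg (val w); rewrite /= -E ltNge ltW.
- congr (Some (inr _)); move: E => /eqP; rewrite eqr_nat eqSS => /eqP/val_inj.
  by rewrite !edge_ofK.
- by have := pos (edge_of k); rewrite /= E ltxx.
- by have := neg (val w); rewrite /= -E ltxx.
- by have := pos (edge_of l); rewrite /= -E ltxx.
Qed.

End CellDimension.

Section ClosedUnion.
Variable P : height_function G -> Prop.

Local Notation D := (closure (\bigcup_(h in P) @cell R G h)).

Definition cell_faces (S : {set {set index}}) : bool :=
  `[< exists h x, [/\ P h, cell h x & S \subset levels (coords x)] >].

Lemma cell_faces_down (S S' : {set {set index}}) :
  S' \subset S -> cell_faces S -> cell_faces S'.
Proof.
move=> SS /asboolP[h [x [Ph cx Sx]]]; apply/asboolP; exists h, x; split=> //.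
exact: fintype.subset_trans SS Sx.
Qed.

(** The points whose gap coordinates are supported in a given face form a closed
    set, there are finitely many faces, and every cell is covered. *)
Lemma closed_cell_faces x : D x -> cell_faces (carrier (fan_coords x)).
Proof.
pose F := \bigcup_(S in [set S | cell_faces S])
  \bigcap_(A in [set A | A \notin S]) [set x : params | fan_coords x A = 0].
have clF : closed F.
  apply: closed_bigcup => [|S _]; first exact: finite_finset.
  apply: closed_bigI => A _.
  apply: (@closed_comp _ _ (fun x => fan_coords x A) [set 0]).
    move=> z _; apply: (@continuous_comp _ _ _ fan_coords
      (fun y : {ptws {set index} -> R} => y A)).
      exact: fan_coords_continuous.
    exact: ptws_eval_continuous.
  exact: closed_eq.
have cellF : \bigcup_(h in P) cell h `<=` F.
  move=> z [h Ph cz]; exists (levels (coords z)) => /=.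
    by apply/asboolP; exists h, z.
  by move=> A /=; rewrite -carrier_gap inE negbK => /eqP.
move=> /(closure_subset cellF)/clF[S /= fS xS].
apply: cell_faces_down fS; apply/fintype.subsetP => A.
rewrite inE; apply: contraR => AS; apply/eqP; exact: xS.
Qed.

(** If the support of y is contained in the set of levels of a point x of a cell,
    then y is the limit, as t decreases to 0, of y plus t times the coordinates
    of x; these have the same support as those of x, so they belong to points
    of the same cell. *)
Lemma of_fan_closed (y : {ptws {set index} -> R}) :
  conical cell_faces y -> D (of_fan y).
Proof.
move=> [y0 /asboolP[h [x [Ph cx yx]]]] B nB.
pose g (t : R) : {ptws {set index} -> R} := fun A => y A + t * fan_coords x A.
have cg : {for 0, continuous (of_fan \o g)}.
  apply: continuous_comp; last exact: of_fan_continuous.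
  apply: ptws_continuous_at => A; apply: add_continuous_at.
    exact: cst_continuous_at.
  by apply: mul_continuous_at; [exact: cvg_id|exact: cst_continuous_at].
have g0 : g 0 = y by apply/funext => A; rewrite /g mul0r addr0.
have : nbhs (0 : R) ((of_fan \o g) @^-1` B) by apply: cg; rewrite /= g0.
move=> /nbhs_ballP[e /= e0 eB].
have e2 : 0 < e / 2 by rewrite divr_gt0.
exists (of_fan (g (e / 2))); split; last first.
  by apply: (eB (e / 2)); rewrite /ball/= sub0r normrN gtr0_norm//; lra.
exists h => //; apply: (cell_levels _ cx).
have gge A : 0 <= g (e / 2) A by rewrite addr_ge0// mulr_ge0 ?gap_ge0// ltW.
have gc : carrier (g (e / 2)) = levels (coords x).
  rewrite -carrier_gap; apply/setP => A; rewrite [LHS]inE [RHS]inE.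
  have [xA|xA] := eqVneq (gap (coords x) A) 0; last first.
    rewrite gt_eqF// ltr_wpDl// mulr_gt0// lt_def xA; exact: gap_ge0.
  rewrite /g /fan_coords xA mulr0 addr0; apply/negbTE; rewrite negbK.
  apply: contraT => yA; have : A \in levels (coords x).
    by apply: (fintype.subsetP yx); rewrite inE.
  by rewrite -carrier_gap inE xA eqxx.
rewrite -gc -[in RHS]carrier_gap; congr carrier.
by rewrite -/(fan_coords _) (of_fanK gge (x := x))// gc.
Qed.

Theorem closed_cells_cw :
  exists K : finite_cw R (one_point_compactification (set_type D)),
    cw_regular K /\
    cw_dim K = (\max_(S | cell_faces S) #|S|)%N.
Proof.
pose f (x : set_type D) := fan_coords (\val x).
have [cv _ _] := set_val_embedding D.
have femb : embedding f.
  split.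
  - move=> x; apply: continuous_comp; [exact: cv|exact: fan_coords_continuous].
  - by move=> x y /(can_inj fan_coordsK)/val_inj.
  move=> U [V oV VU]; exists (of_fan @^-1` V).
    by apply: open_comp oV => y _; exact: of_fan_continuous.
  rewrite -VU; apply/seteqP.
  by split=> x; rewrite /f /= fan_coordsK.
apply: (conical_complex femb _ cell_faces_down).
apply/seteqP; split=> [_ [x _ <-]|y cy].
  split=> [A|]; first exact: gap_ge0.
  by apply: closed_cell_faces; case: (x) => z /= /set_mem.
exists (exist _ (of_fan y) (mem_set (of_fan_closed cy))) => //.
have [y0 /asboolP[h [x [_ _ yx]]]] := cy; exact: of_fanK y0 yx.
Qed.

Lemma cell_faces_dim d : (forall h, P h -> is_cell R d h) -> D !=set0 ->
  (\max_(S | cell_faces S) #|S|)%N = d.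
Proof.
move=> Pd D0; have [h Ph] : exists h, P h.
  apply: contrapT => nP; have [x] := D0.
  rewrite (_ : \bigcup_(h in P) cell h = set0) ?closure0//.
  by apply/seteqP; split=> // z [h Ph]; case: nP; exists h.
apply/eqP; rewrite eqn_leq; apply/andP; split.
  apply/bigmax_leqP => S /asboolP[h' [x [Ph' [_ hx] Sx]]].
  have [_ <-] := Pd h' Ph'.
  exact: leq_trans (subset_leq_card Sx) (card_levels_cell hx).
have [[x cx] <-] := Pd h Ph; rewrite -card_levels_generic.
apply: (@leq_bigmax_cond _ cell_faces (fun S => #|S|)).
apply/asboolP; exists h, (generic_point h); split=> //.
exact: cell_height cx (generic_height h).
Qed.

End ClosedUnion.

Lemma U_at_open v : open (@U_at R G v).
Proof.
rewrite openE => x Ux; rewrite /interior.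
apply: (@filter_forall params (gV G)
  (fun u z => u != v -> z.1 v < z.1 u) (nbhs x)) => u; have [->|uv] := eqVneq u v.
  by apply: nearW => z /eqP.
have c : {for x, continuous (fun z => coords z (Some (inl u)) -
    coords z (Some (inl v)))}.
  by apply: sub_continuous_at; exact: coords_continuous.
have : \forall z \near x, 0 < coords z (Some (inl u)) - coords z (Some (inl v)).
  apply: (c [set t | 0 < t]); apply: open_nbhs_nbhs; split; first exact: open_gt.
  by rewrite /= subr_gt0; exact: Ux.
by apply: filterS => z; rewrite subr_gt0.
Qed.

(** Lowering E at one of its minima makes this minimum unique. *)
Lemma U_dense : (0 < #|gV G|)%N -> dense (\bigcup_v @U_at R G v).
Proof.
move=> /card_gt0P[v0 _] O [x Ox] oO.
case: (@arg_minP _ _ _ v0 xpredT x.1 isT) => v _ xv.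
pose g (t : R) : params := (fun u => x.1 u - (if u == v then t else 0), x.2).
have cg : {for 0, continuous g}.
  apply: params_continuous => [u|e]; last exact: cst_continuous_at.
  apply: sub_continuous_at; first exact: cst_continuous_at.
  by case: (u == v); [exact: cvg_id|exact: cst_continuous_at].
have g0 : g 0 = x.
  rewrite [RHS]surjective_pairing; congr pair.
  by apply/funext => u; rewrite if_same subr0.
have : nbhs (0 : R) (g @^-1` O).
  by apply: cg; rewrite g0; exact: open_nbhs_nbhs.
move=> /nbhs_ballP[e /= e0 eO].
have e2 : 0 < e / 2 by rewrite divr_gt0.
exists (g (e / 2)); split.
  by apply: eO; rewrite /ball/= sub0r normrN gtr0_norm//; lra.
exists v => // u uv; rewrite /= eqxx (negbTE uv) subr0.
by have := xv u isT; lra.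
Qed.

Lemma discriminant_avoids_U :
  @discriminant R G `<=` ~` (\bigcup_v @U_at R G v).
Proof.
rewrite /discriminant => x Dx.
have cl : closed (~` (\bigcup_v @U_at R G v)).
  by apply/open_closedC/bigcup_open => v _; exact: U_at_open.
apply: cl; apply: closure_subset Dx => z [h _ [bz _]] [v _ Uz].
by apply: bz; left; exists v.
Qed.

End DiscriminantCells.

Theorem theorem3 (R : realType) (G : graph) (hG : connected_graph G) :
  (exists K : finite_cw R
       (one_point_compactification (set_type (@discriminant R G))),
     cw_regular K /\
     (@discriminant R G !=set0 -> cw_dim K = top_dim G)) /\
  open (~` @discriminant R G) /\ dense (~` @discriminant R G).
Proof.
split; last first.
  split; first by apply: closed_openC; exact: closed_closure.
  have /andP[V0 _] := hG.
  move=> O O0 oO; have [x [Ox Ux]] := U_dense V0 O0 oO.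
  by exists x; split=> // /discriminant_avoids_U.
have [K [Kreg Kdim]] := closed_cells_cw R (@essential R G).
exists K; split=> // D0; rewrite Kdim.
by apply: cell_faces_dim D0 => h [].
Qed.
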